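(* Let $\underline\alpha$ be generic, $\mathbf h=(h_1>\cdots>h_n)$ integers and $D\in\Phi\Gamma_{\mathrm{nc}}(\underline\alpha,\mathbf h)$. There exists a unique action of $A_D$ on $\pi^{\mathrm{univ}}$ (commuting with $\mathrm{GL}_n(\mathbb Q_p)$) such that for each $w\in S_n$, the $A_D$-action on its subrepresentation $\pi^{\mathrm{univ}}_w$ factors through the natural $A_{D,w}$-action. Moreover, $\pi_1(D)\cong\pi^{\mathrm{univ}}[\mathfrak m_{A_D}]$, where $[\mathfrak m_{A_D}]$ denotes the subspace annihilated by the maximal ideal $\mathfrak m_{A_D}$ of $A_D$.
   Context: **Galois side.** $E$ is a finite extension of $\mathbb Q_p$ (coefficients). $\mathrm{unr}(a)$ is the unramified character of $\mathbb Q_p^\times$ sending $p$ to $a$; $z^k$ is $x\mapsto x^k$; $|p|=p^{-1}$; $\varepsilon(x)=x|x|$ (cyclotomic character, Hodge-Tate weight $1$). $T\subset B\subset\mathrm{GL}_n$ are the diagonal torus and upper triangular Borel, $B^-$ the lower triangular Borel. $\mathrm{Hom}(H,E)$ denotes locally analytic homomorphisms to the additive group $E$. $\mathcal R_A$ is the Robba ring of $\mathbb Q_p$ with coefficients in $A$ and $\mathcal R_A(\delta)$ the rank one $(\varphi,\Gamma)$-module attached to a continuous $\delta:\mathbb Q_p^\times\to A^\times$. Generic means: $\underline\alpha=(\alpha_1,\dots,\alpha_n)\in(E^\times)^n$, $\alpha_i\ne\alpha_j$ and $\alpha_i\alpha_j^{-1}\neq p$ for $i\neq j$. For $w\in S_n$,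 $w(\underline\alpha)=(\alpha_{w^{-1}(1)},\dots,\alpha_{w^{-1}(n)})$. $\Phi\Gamma_{\mathrm{nc}}(\underline\alpha,\mathbf h)$ is the set of isomorphism classes of crystalline $(\varphi,\Gamma)$-modules $D$ of rank $n$ over $\mathcal R_E$ with $\varphi$-eigenvalues $\underline\alpha$ on $D_{\mathrm{cris}}(D)$, Hodge-Tate weights $\mathbf h$, which are non-critical: for every $w\in S_n$, $D$ has a filtration by saturated $(\varphi,\Gamma)$-submodules with $i$-th graded piece $\mathcal R_E(\mathrm{unr}(\alpha_{w^{-1}(i)})z^{h_i})$. Elements of $\mathrm{Ext}^1_{(\varphi,\Gamma)}(D,D)$ are viewed as deformations $\widetilde D$ of $D$ over $\mathcal R_{E[\epsilon]/\epsilon^2}$. $\mathrm{Ext}^1_w(D,D)$ is the subspace of those $\widetilde D$ that are successive extensions of $\mathcal R_{E[\epsilon]/\epsilon^2}(\mathrm{unr}(\alpha_{w^{-1}(i)})z^{h_i}(1+\psi_i\epsilon))$, $i=1,\dots,n$, and $\kappa_w:\mathrm{Ext}^1_w(D,D)\to\mathrm{Hom}(T(\mathbb Q_p),E)$ sends $\widetilde D$ to $(\psi_1,\dots,\psi_n)$. $\kappa_w$ is surjective and $\mathrm{Ext}^1_0(D,D):=\mathrm{Ker}\,\kappa_w$ does not depend on $w$; $\overline{\mathrm{Ext}}^1_?:=\mathrm{Ext}^1_?/\mathrm{Ext}^1_0$. So $\kappa_w:\overline{\mathrm{Ext}}^1_w(D,D)\xrightarrow{\sim}\mathrm{Hom}(T(\mathbb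 Q_p),E)$. $R_D$ is the universal deformation ring of $D$ over local Artinian $E$-algebras, $\mathfrak m$ its maximal ideal, so $R_D/\mathfrak m^2=E\oplus\mathrm{Ext}^1_{(\varphi,\Gamma)}(D,D)^\vee$. $A_D\subset R_D/\mathfrak m^2$ is the local Artinian $E$-subalgebra $E\oplus\overline{\mathrm{Ext}}^1_{(\varphi,\Gamma)}(D,D)^\vee$, and $A_{D,w}$ is its quotient $E\oplus\overline{\mathrm{Ext}}^1_w(D,D)^\vee$. **Automorphic side.** $\theta=(0,-1,\dots,1-n)$, $\varepsilon^{-1}\circ\theta$ is the character $(a_i)\mapsto\prod_i\varepsilon(a_i)^{i-1}$ of $T(\mathbb Q_p)$, $\eta=1\boxtimes|\cdot|\boxtimes\cdots\boxtimes|\cdot|^{n-1}$. $\pi_{\mathrm{sm}}(\underline\alpha)=(\mathrm{Ind}_{B^-(\mathbb Q_p)}^{\mathrm{GL}_n(\mathbb Q_p)}\mathrm{unr}(\underline\alpha)\eta)^\infty$ (unnormalized smooth induction; irreducible, unchanged up to isomorphism if $\underline\alpha$ is replaced by $w(\underline\alpha)$), $\pi_{\mathrm{alg}}(\underline\alpha,\mathbf h)=\pi_{\mathrm{sm}}(\underline\alpha)\otimes_E L(\mathbf h-\theta)$ with $L(\mu)$ the algebraic representation of highest weight $\mu$. $\mathrm{PS}(w,\underline\alpha,\mathbf h)=(\mathrm{Ind}_{B^-(\mathbb Q_p)}^{\mathrm{GL}_n(\mathbb Q_p)}\mathrm{unr}(w(\underline\alpha))z^{\mathbf h}(\varepsilon^{-1}\circ\theta))^{\mathrm{an}}$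 (locally analytic induction), whose socle is $\pi_{\mathrm{alg}}(\underline\alpha,\mathbf h)$; fix embeddings $\pi_{\mathrm{alg}}(\underline\alpha,\mathbf h)\hookrightarrow\mathrm{PS}(w,\underline\alpha,\mathbf h)$. $\pi(\underline\alpha,\mathbf h)$ is the unique quotient with socle $\pi_{\mathrm{alg}}(\underline\alpha,\mathbf h)$ of the amalgamated sum of all $\mathrm{PS}(w,\underline\alpha,\mathbf h)$, $w\in S_n$, along $\pi_{\mathrm{alg}}(\underline\alpha,\mathbf h)$. $\mathrm{Ext}^1_{\mathrm{GL}_n(\mathbb Q_p)}$ is the extension group of admissible locally analytic representations. $\zeta_w:\mathrm{Hom}(T(\mathbb Q_p),E)\to\mathrm{Ext}^1_{\mathrm{GL}_n(\mathbb Q_p)}(\pi_{\mathrm{alg}}(\underline\alpha,\mathbf h),\pi(\underline\alpha,\mathbf h))$ sends $\psi$ to the self-extension $(\mathrm{Ind}_{B^-(\mathbb Q_p)}^{\mathrm{GL}_n(\mathbb Q_p)}\mathrm{unr}(w(\underline\alpha))z^{\mathbf h}(\varepsilon^{-1}\circ\theta)(1+\psi\epsilon))^{\mathrm{an}}$ of $\mathrm{PS}(w,\underline\alpha,\mathbf h)$, pulled back along $\pi_{\mathrm{alg}}\hookrightarrow\mathrm{PS}(w)$ and pushed forward along $\mathrm{PS}(w)\hookrightarrow\pi(\underline\alpha,\mathbf h)$. It is injective with image denoted $\mathrm{Ext}^1_w(\pi_{\mathrm{alg}}(\underline\alpha,\mathbf h),\pi(\underline\alpha,\mathbf h))$. For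 a subspace $W\subset\mathrm{Ext}^1_{\mathrm{GL}_n(\mathbb Q_p)}(\pi_{\mathrm{alg}}(\underline\alpha,\mathbf h),\pi(\underline\alpha,\mathbf h))$, the tautological extension of $\pi_{\mathrm{alg}}(\underline\alpha,\mathbf h)\otimes_EW$ by $\pi(\underline\alpha,\mathbf h)$ is the amalgamated sum along $\pi(\underline\alpha,\mathbf h)$ of the extensions corresponding to a basis of $W$. $\pi^{\mathrm{univ}}$, resp. $\pi^{\mathrm{univ}}_w\subset\pi^{\mathrm{univ}}$, is the tautological extension for $W$ the full $\mathrm{Ext}^1$, resp. for $W=\mathrm{Ext}^1_w(\pi_{\mathrm{alg}}(\underline\alpha,\mathbf h),\pi(\underline\alpha,\mathbf h))$. The natural $A_{D,w}$-action on $\pi_w^{\mathrm{univ}}$: $x\in\mathfrak m_{A_{D,w}}\cong\overline{\mathrm{Ext}}^1_w(D,D)^\vee\cong\mathrm{Ext}^1_w(\pi_{\mathrm{alg}}(\underline\alpha,\mathbf h),\pi(\underline\alpha,\mathbf h))^\vee$ (second isomorphism via $\zeta_w\circ\kappa_w$) acts by $\pi_w^{\mathrm{univ}}\twoheadrightarrow\pi_{\mathrm{alg}}(\underline\alpha,\mathbf h)\otimes_E\mathrm{Ext}^1_w(\pi_{\mathrm{alg}}(\underline\alpha,\mathbf h),\pi(\underline\alpha,\mathbf h))\xrightarrow{x}\pi_{\mathrm{alg}}(\underline\alpha,\mathbf h)\hookrightarrow\pi_w^{\mathrm{univ}}$. **$\pi_1(D)$.** There is a unique linear map $t_D:\mathrm{Ext}^1_{\mathrm{GL}_n(\mathbb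 Q_p)}(\pi_{\mathrm{alg}}(\underline\alpha,\mathbf h),\pi(\underline\alpha,\mathbf h))\to\overline{\mathrm{Ext}}^1_{(\varphi,\Gamma)}(D,D)$ such that for all $w\in S_n$, $t_D\circ\zeta_w$ equals $\mathrm{Hom}(T(\mathbb Q_p),E)\xrightarrow{\kappa_w^{-1}}\overline{\mathrm{Ext}}^1_w(D,D)\hookrightarrow\overline{\mathrm{Ext}}^1_{(\varphi,\Gamma)}(D,D)$. $\pi_1(D)$ is the tautological extension of $\pi_{\mathrm{alg}}(\underline\alpha,\mathbf h)\otimes_E\mathrm{Ker}(t_D)$ by $\pi(\underline\alpha,\mathbf h)$. *)

(* Defs.v *)
From HB Require Import structures.
From mathcomp Require Import all_boot all_order all_algebra all_fingroup.
From mathcomp Require Import all_field.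
From mathcomp Require Import boolp classical_sets functions reals.

Set Implicit Arguments.
Unset Strict Implicit.
Unset Printing Implicit Defensive.

Import Order.TTheory GRing.Theory Num.Theory.
Local Open Scope ring_scope.

(******************************************************************************)
(*                     p-adic numbers and coefficient fields                  *)
(******************************************************************************)

(* Q_p up to unique isomorphism: a complete discretely valued field with      *)
(* v(p) = 1 in which Q is dense.  The value of [vp] at 0 is irrelevant.       *)
Structure padicField (p : nat) := PadicField {
  Qp :> fieldType;
  Qp_prime : prime p;
  vp : Qp -> int;
  vge := fun (m : int) (x : Qp) => (x == 0) || (m <= vp x);
  vpM : forall x y, x != 0 -> y != 0 -> vp (x * y) = vp x + vp y;
  vpD : forall m x y, vge m x -> vge m y -> vge m (x + y);
  vp_pn0 : p%:R != 0 :> Qp;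
  vp_p : vp p%:R = 1;
  vp_dense : forall (x : Qp) (m : int), exists r : rat, vge m (x - ratr r);
  vp_complete : forall u : nat -> Qp,
    (forall m : int, exists n0 : nat, forall i j : nat,
       (n0 <= i)%N -> (n0 <= j)%N -> vge m (u i - u j)) ->
    exists l : Qp, forall m : int, exists n0 : nat, forall i : nat,
       (n0 <= i)%N -> vge m (u i - l)
}.

(* A finite extension E of Q_p with the unique extension of the p-adic        *)
(* absolute value, |p| = 1/p.                                                 *)
Structure coefField (R : realType) (p : nat) (K : padicField p) := CoefField {
  coefE :> fieldExtType K;
  nrm : coefE -> R;
  nrm_ge0 : forall x, 0 <= nrm x;
  nrm_eq0 : forall x, (nrm x == 0) = (x == 0);
  nrmM : forall x y, nrm (x * y) = nrm x * nrm y;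
  nrmD : forall x y, nrm (x + y) <= Num.max (nrm x) (nrm y);
  nrm_vp : forall x : K, x != 0 -> nrm x%:A = p%:R ^ (- vp x)
}.

Definition zpunit (p : nat) (K : padicField p) (a : K) : bool :=
  (a != 0) && (vp a == 0).

(* unr(a) z^k, for a in E^x and k in Z.                                       *)
Definition unrz (R : realType) (p : nat) (K : padicField p)
    (E : coefField R K) (a : E) (k : int) (x : K) : E :=
  a ^ (vp x) * x%:A ^ k.

(* |x| = p^(- v(x)) as an element of E.                                       *)
Definition absE (R : realType) (p : nat) (K : padicField p)
    (E : coefField R K) (x : K) : E := p%:R ^ (- vp x).

(* The cyclotomic character x |x|.                                            *)
Definition cyclo (R : realType) (p : nat) (K : padicField p)
    (E : coefField R K) (x : K) : E := x%:A * absE E x.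

(* The subspace of V cut out by a predicate, as an E-vector space.            *)
Definition subspace_prop (F : fieldType) (V : lmodType F) (P : V -> Prop) :=
  P 0 /\ forall a u v, P u -> P v -> P (a *: u + v).

Section SubLmod.
Context (F : fieldType) (V : lmodType F) (P : V -> Prop).
Context (HP : subspace_prop P).

Definition sublmod_pred (_ : subspace_prop P) : {pred V} := fun v => `[< P v >].

Lemma sublmod_closed : submod_closed (sublmod_pred HP).
Proof.
split; first exact/asboolP/HP.1.
by move=> a u v /asboolP Pu /asboolP Pv; apply/asboolP/HP.2.
Qed.

HB.instance Definition _ :=
  GRing.isSubmodClosed.Build F V (sublmod_pred HP) sublmod_closed.

Record sublmod := SubLmod {
  sublmod_val :> V;
  sublmod_valP : sublmod_val \in sublmod_pred HP
}.
HB.instance Definition _ := [isSub for sublmod_val].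
HB.instance Definition _ := [Choice of sublmod by <:].
HB.instance Definition _ := [SubChoice_isSubLmodule of sublmod by <:].

Lemma sublmodP (v : sublmod) : P v.
Proof. by case: v => v /= /asboolP. Qed.

End SubLmod.

Section Seminorms.
Context (R : realType) (p : nat) (K : padicField p) (E : coefField R K).

Definition seminorm (V : lmodType E) (q : V -> R) : Prop :=
  [/\ forall v, 0 <= q v, forall a v, q (a *: v) = nrm a * q v
    & forall u v, q (u + v) <= Num.max (q u) (q v)].

(* A locally convex topology on V is given by the set of ALL its continuous   *)
(* (nonarchimedean) seminorms.                                                *)
Definition is_lctop (V : lmodType E) (cs : (V -> R) -> Prop) : Prop :=
  [/\ forall q, cs q -> seminorm q,
      cs (fun=> 0),
      forall q q', cs q -> cs q' -> cs (fun v => Num.max (q v) (q' v))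
    & forall q q' (C : R), cs q -> seminorm q' ->
        (forall v, q' v <= C * q v) -> cs q'].

Definition hausdorff_lc (V : lmodType E) (cs : (V -> R) -> Prop) : Prop :=
  forall v, v != 0 -> exists2 q, cs q & 0 < q v.

(* A BH-space of V: a subspace B with a complete nonarchimedean norm N for    *)
(* which the inclusion of B in V is continuous.                               *)
Definition is_bh (V : lmodType E) (cs : (V -> R) -> Prop)
    (B : V -> Prop) (N : V -> R) : Prop :=
  [/\ subspace_prop B,
      [/\ forall v, B v -> 0 <= N v, forall v, B v -> N v = 0 -> v = 0,
          forall a v, B v -> N (a *: v) = nrm a * N v
        & forall u v, B u -> B v -> N (u + v) <= Num.max (N u) (N v)],
      forall u : nat -> V, (forall k, B (u k)) ->
        (forall e : R, 0 < e -> exists n0 : nat, forall i j : nat,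
           (n0 <= i)%N -> (n0 <= j)%N -> N (u i - u j) < e) ->
        exists2 l, B l & forall e : R, 0 < e -> exists n0 : nat,
          forall i : nat, (n0 <= i)%N -> N (u i - l) < e
    & forall q, cs q -> exists C : R, forall v, B v -> q v <= C * N v].

(******************************************************************************)
(*        Power series in finitely many variables, vector coefficients        *)
(******************************************************************************)

Definition mdeg (I : finType) (b : {ffun I -> nat}) : nat := (\sum_i b i)%N.

Definition monE (I : finType) (x : I -> K) (b : {ffun I -> nat}) : E :=
  (\prod_i x i ^+ b i)%:A.

(* Sum over the multi-indices all of whose entries are < M.                   *)
Definition psum (I : finType) (V : lmodType E) (c : {ffun I -> nat} -> V)
    (x : I -> K) (M : nat) : V :=
  \sum_(b : {ffun I -> 'I_M})
     monE x [ffun i => b i : nat] *: c [ffun i => b i : nat].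

(* The coefficients c tend to 0, for N, on the polydisc (p^m Z_p)^I, and      *)
(* their power series represents u there.                                     *)
Definition analytic (I : finType) (V : lmodType E) (N : V -> R) (m : nat)
    (u : (I -> K) -> V) (c : {ffun I -> nat} -> V) : Prop :=
  (forall e : R, 0 < e -> exists d : nat, forall b, (d <= mdeg b)%N ->
     N (c b) * p%:R ^- (m * mdeg b) < e) /\
  (forall x : I -> K, (forall i, vge m%:Z (x i)) ->
     forall e : R, 0 < e -> exists M0 : nat, forall M : nat, (M0 <= M)%N ->
       N (u x - psum c x M) < e).

(* The N-norm of the power series c on (p^m Z_p)^I is at most k.              *)
Definition coef_le (I : finType) (V : lmodType E) (N : V -> R) (m : nat)
    (c : {ffun I -> nat} -> V) (k : R) : Prop :=
  forall b, N (c b) * p%:R ^- (m * mdeg b) <= k.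

Lemma psumP (I : finType) (V : lmodType E) (a : E)
    (c c' : {ffun I -> nat} -> V) (x : I -> K) (M : nat) :
  psum (fun b => a *: c b + c' b) x M = a *: psum c x M + psum c' x M.
Proof.
rewrite /psum scaler_sumr -big_split /=; apply: eq_bigr => b _.
by rewrite scalerDr !scalerA mulrC.
Qed.

Lemma analytic_lin (I : finType) (V : lmodType E) (N : V -> R) (m m' : nat)
    (u u' : (I -> K) -> V) (c c' : {ffun I -> nat} -> V) (a : E) :
  seminorm N -> analytic N m u c -> analytic N m' u' c' ->
  analytic N (maxn m m') (fun x => a *: u x + u' x)
    (fun b => a *: c b + c' b).
Proof.
move=> [N0 NZ ND] [c0 cu] [c0' cu'].
have p_gt0 : (0 < p)%N by apply: prime_gt0; exact: Qp_prime K.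
have pge1 : 1 <= p%:R :> R by rewrite ler1n.
have pw i j (k : nat) : (i <= j)%N -> p%:R ^- (j * k) <= p%:R ^- (i * k) :> R.
  move=> lij; rewrite lef_pV2 ?posrE ?exprn_gt0 ?ltr0n //.
  by apply: ler_weXn2l => //; rewrite leq_mul2r lij orbT.
pose A := nrm a + 1.
have A_gt0 : 0 < A by rewrite ltr_wpDl ?nrm_ge0.
have aN v : N (a *: v) <= A * N v.
  by rewrite NZ ler_wpM2r ?N0 // lerDl ler01.
have lt_A v (e : R) : N v < e / A -> N (a *: v) < e.
  by move=> h; apply: le_lt_trans (aN v) _; rewrite mulrC -ltr_pdivlMr.
split=> [e e_gt0|x xm e e_gt0].
  have [d hd] := c0 _ (divr_gt0 e_gt0 A_gt0).
  have [d' hd'] := c0' _ e_gt0.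
  exists (maxn d d') => b; rewrite geq_max => /andP[db db'].
  set P := p%:R ^- _.
  have P_ge0 : 0 <= P by rewrite invr_ge0 exprn_ge0 ?ler0n.
  apply: le_lt_trans (ler_wpM2r P_ge0 (ND _ _)) _.
  rewrite maxr_pMl // gt_max; apply/andP; split.
    apply: le_lt_trans (ler_wpM2r P_ge0 (aN _)) _.
    rewrite -mulrA mulrC -ltr_pdivlMr //.
    apply: le_lt_trans _ (hd b db).
    by rewrite ler_wpM2l ?N0 ?pw ?leq_maxl.
  apply: le_lt_trans _ (hd' b db').
  by rewrite ler_wpM2l ?N0 ?pw ?leq_maxr.
have vw i j (y : K) : (i <= j)%N -> vge j%:Z y -> vge i%:Z y.
  move=> lij /orP[y0|jy]; first by rewrite /vge y0.
  by rewrite /vge (le_trans _ jy) ?orbT // lez_nat.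
have [M hM] := cu x (fun i => vw _ _ _ (leq_maxl m m') (xm i)) _
                  (divr_gt0 e_gt0 A_gt0).
have [M' hM'] := cu' x (fun i => vw _ _ _ (leq_maxr m m') (xm i)) _ e_gt0.
exists (maxn M M') => L; rewrite geq_max => /andP[LM LM'].
rewrite psumP opprD addrACA -scalerBr.
apply: le_lt_trans (ND _ _) _; rewrite gt_max hM' // andbT.
exact/lt_A/hM.
Qed.


Lemma seminorm0 (V : lmodType E) (N : V -> R) : seminorm N -> N 0 = 0.
Proof.
case=> _ NZ _; rewrite -(scale0r (0 : V)) NZ.
have /eqP -> : nrm (0 : E) == 0 by rewrite nrm_eq0.
by rewrite mul0r.
Qed.

Lemma analytic0 (I : finType) (V : lmodType E) (N : V -> R) :
  seminorm N -> analytic N 0 (fun _ : I -> K => 0) (fun=> 0).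
Proof.
move=> sN; have N0 := seminorm0 sN; split=> [e e0|x _ e e0].
  by exists 0%N => b _; rewrite N0 mul0r.
exists 0%N => M _; rewrite /psum big1 ?subr0 ?N0 // => b _.
by rewrite scaler0.
Qed.

End Seminorms.

(******************************************************************************)
(*                  Locally analytic characters of Q_p^x                      *)
(******************************************************************************)

Section Functions.
Context (R : realType) (p : nat) (K : padicField p) (E : coefField R K).

Local Notation nE := (@nrm R p K E : E^o -> R).

Lemma nrm_seminorm : seminorm nE.
Proof. by split; [exact: nrm_ge0 | exact: nrmM | exact: nrmD]. Qed.

(* The function f is given by a convergent power series around x0.            *)
Definition la_at1 (f : K -> E^o) (x0 : K) : Prop :=
  exists m c, analytic nE m
    (fun x : unit -> K => f (x0 + x tt)) c.

(* Locally analytic homomorphisms Q_p^x -> E, extended by 0 at 0.             *)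
Definition la_hom (f : K -> E^o) : Prop :=
  [/\ f 0 = 0, forall x y, x != 0 -> y != 0 -> f (x * y) = f x + f y
    & forall x, x != 0 -> la_at1 f x].

Lemma la_hom_subspace : subspace_prop la_hom.
Proof.
split; first split=> // [x y _ _|x _]; first by rewrite addr0.
  by exists 0%N, (fun=> 0); exact: analytic0 nrm_seminorm.
move=> a u v [u0 uM ula] [v0 vM vla]; split=> [|x y x0 y0|x x0].
- by rewrite !fctE u0 v0 scaler0 addr0.
- by rewrite !fctE uM // vM // scalerDr addrACA.
have [m [c h]] := ula x x0; have [m' [c' h']] := vla x x0.
by do 2!eexists; exact: (analytic_lin a nrm_seminorm h h').
Qed.

Definition laHom := sublmod la_hom_subspace.
HB.instance Definition _ := GRing.Lmodule.on laHom.

(* Hom(T(Q_p), E), T the diagonal torus of GL_n, is Hom(Q_p^x, E)^n.          *)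
Definition homT (n : nat) := {ffun 'I_n -> laHom}.
HB.instance Definition _ (n : nat) := GRing.Lmodule.on (homT n).

End Functions.

(******************************************************************************)
(*           Admissible locally analytic representations of GL_n(Q_p)         *)
(******************************************************************************)

(* Raw data: space, continuous seminorms, action.  The action is only         *)
(* meaningful on invertible matrices.                                         *)
Structure rep (R : realType) (p : nat) (K : padicField p) (E : coefField R K)
    (n : nat) := Rep {
  rep_space :> lmodType E;
  rep_cs : (rep_space -> R) -> Prop;
  rep_act : 'M[K]_n -> rep_space -> rep_space
}.
Arguments rep_cs {R p K E n} _ _.
Arguments rep_act {R p K E n _} _ _.

Section Reps.
Context (R : realType) (p : nat) (K : padicField p) (E : coefField R K).
Context (n : nat).

Local Notation repr := (rep E n).
Local Notation nE := (@nrm R p K E : E^o -> R).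
Local Notation idx := ('I_n * 'I_n)%type.

Definition mx_of (x : idx -> K) : 'M[K]_n := \matrix_(i, j) x (i, j).

(* Chart of GL_n(Q_p) around g.                                               *)
Definition chart (g : 'M[K]_n) (x : idx -> K) : 'M[K]_n :=
  (1%:M + mx_of x) *m g.

Definition lower_borel (b : 'M[K]_n) : bool := is_trig_mx b && (b \in unitmx).

(* GL_n(Z_p).                                                                 *)
Definition glZp (g : 'M[K]_n) : Prop :=
  (forall i j, vge 0 (g i j)) /\ zpunit (\det g).

(* Topological representations: continuous action on a locally convex space.  *)
Definition top_rep (V : repr) : Prop :=
  [/\ is_lctop (rep_cs V),
      forall g, g \in unitmx -> linear (rep_act g : V -> V),
      forall v : V, rep_act 1%:M v = v,
      forall g h (v : V), g \in unitmx -> h \in unitmx ->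
        rep_act (g *m h) v = rep_act g (rep_act h v)
    & forall g q, g \in unitmx -> rep_cs V q ->
        rep_cs V (fun v => q (rep_act g v))].

Definition rep_mor (V W : repr) (f : V -> W) : Prop :=
  [/\ linear f,
      forall g v, g \in unitmx -> f (rep_act g v) = rep_act g (f v)
    & forall q, rep_cs W q -> rep_cs V (fun v => q (f v))].

(* The orbit map of v is locally analytic.                                    *)
Definition la_vector (V : repr) (v : V) : Prop :=
  forall g, g \in unitmx -> exists (m : nat) (B : V -> Prop) (N : V -> R) c,
    [/\ is_bh (rep_cs V) B N, forall b, B (c b),
        forall x, (forall ij, vge m%:Z (x ij)) ->
          B (rep_act (chart g x) v)
      & analytic N m (fun x => rep_act (chart g x) v) c].

(* LB-spaces: countable locally convex inductive limits of Banach spaces.     *)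
Definition lb_space (V : repr) : Prop :=
  exists (B : nat -> V -> Prop) (N : nat -> V -> R),
    [/\ forall k, is_bh (rep_cs V) (B k) (N k),
        forall k, exists C : R, forall v, B k v ->
          B k.+1 v /\ N k.+1 v <= C * N k v,
        forall v, exists k, B k v
      & forall q, seminorm q ->
          (forall k, exists C : R, forall v, B k v -> q v <= C * N k v) ->
          rep_cs V q].

(* The orbit map of v on H = 1 + p^m M_n(Z_p) is rigid analytic, with values  *)
(* in the BH-space (B, N), and c is its power series.                         *)
Definition an_vector_in (m : nat) (V : repr) (B : V -> Prop) (N : V -> R)
    (c : {ffun idx -> nat} -> V) (v : V) : Prop :=
  [/\ is_bh (rep_cs V) B N, forall b, B (c b),
      forall x, (forall ij, vge m%:Z (x ij)) -> B (rep_act (chart 1%:M x) v)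
    & analytic N m (fun x => rep_act (chart 1%:M x) v) c].

Definition an_vector (m : nat) (V : repr) (v : V) : Prop :=
  exists B N c, an_vector_in m B N c v.

(* Continuous linear forms on the space V_{H-an} of H-analytic vectors, which *)
(* carries the inductive limit topology over the BH-spaces of V.              *)
Definition an_dual (m : nat) (V : repr) (l : V -> E) : Prop :=
  (forall a u v, an_vector m u -> an_vector m v ->
     l (a *: u + v) = a * l u + l v) /\
  (forall B N, is_bh (rep_cs V) B N -> exists C : R, forall c v k,
     an_vector_in m B N c v -> coef_le N m c k -> nrm (l v) <= C * k).

(* Rigid analytic functions on H, in the coordinate x = h - 1, and the dual   *)
(* D^an(H, E) of C^an(H, E).                                                  *)
Definition an_fun (m : nat) (u : (idx -> K) -> E^o) : Prop :=
  exists c, analytic nE m u c.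

Definition an_dist (m : nat) (mu : ((idx -> K) -> E^o) -> E) : Prop :=
  (forall a u u', an_fun m u -> an_fun m u' ->
     mu (fun x => a *: u x + u' x) = a * mu u + mu u') /\
  (exists C : R, forall u c k,
     analytic nE m u c -> coef_le nE m c k -> nrm (mu u) <= C * k).

(* The dual of V_{H-an} is finitely generated over D^an(H, E).                *)
Definition an_fg (m : nat) (V : repr) : Prop :=
  exists (k : nat) (l : 'I_k -> V -> E), (forall i, an_dual m (l i)) /\
    forall l', an_dual m l' ->
    exists mu : 'I_k -> ((idx -> K) -> E^o) -> E,
      (forall i, an_dist m (mu i)) /\
      forall v, an_vector m v ->
        l' v = \sum_i mu i (fun x => l i (rep_act (chart 1%:M x) v)).

(* Admissible locally analytic representations, in Emerton's form (equivalent *)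
(* to that of Schneider and Teitelbaum).  LB-spaces are barrelled.            *)
Definition admissible (V : repr) : Prop :=
  [/\ top_rep V /\ hausdorff_lc (rep_cs V), lb_space V,
      forall v : V, la_vector v
    & forall m0 : nat, exists2 m : nat, (m0 < m)%N & an_fg m V].

(******************************************************************************)
(*   Subrepresentations, socle, amalgamated sums, extensions                  *)
(******************************************************************************)

Definition closed_subrep (V : repr) (U : V -> Prop) : Prop :=
  [/\ subspace_prop U,
      forall g v, g \in unitmx -> U v -> U (rep_act g v)
    & forall v, ~ U v -> exists q (e : R),
        [/\ rep_cs V q, 0 < e & forall u, U u -> e <= q (v - u)]].

Definition irreducible_subrep (V : repr) (U : V -> Prop) : Prop :=
  [/\ closed_subrep U, exists2 v, U v & v != 0
    & forall U' : V -> Prop, closed_subrep U' -> (forall v, U' v -> U v) ->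
        (exists2 v, U' v & v != 0) -> forall v, U v -> U' v].

(* The socle: sum of all (topologically) irreducible closed                   *)
(* subrepresentations.                                                        *)
Definition socle (V : repr) (v : V) : Prop :=
  exists (k : nat) (u : 'I_k -> V), v = \sum_i u i /\
    forall i, exists2 U, irreducible_subrep U & U (u i).

Definition strict_embedding (V W : repr) (f : V -> W) : Prop :=
  [/\ rep_mor f, injective f
    & forall r, rep_cs V r -> exists2 q, rep_cs W q & forall v, r v <= q (f v)].

Definition strict_quotient (V W : repr) (f : V -> W) : Prop :=
  [/\ rep_mor f, forall w, exists v, f v = w
    & forall r, seminorm r -> rep_cs V (fun v => r (f v)) -> rep_cs W r].

(* Extensions 0 -> A -> M -> B -> 0 of admissible representations.            *)
Record repExt (B A : repr) := RepExt {
  re_mid :> repr;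
  re_i : A -> re_mid;
  re_q : re_mid -> B;
  re_adm : admissible re_mid;
  re_iP : strict_embedding re_i;
  re_qP : strict_quotient re_q;
  re_exact : forall v, re_q v = 0 <-> exists x, v = re_i x
}.

Arguments re_i {B A} _ _.
Arguments re_q {B A} _ _.

(* e' is the push-out of e by the multiplication by a on A.                   *)
Definition rep_scaled (B A : repr) (a : E) (e e' : repExt B A) : Prop :=
  exists f : e -> e', [/\ rep_mor f, forall x, f (re_i e x) = re_i e' (a *: x)
                        & forall v, re_q e' (f v) = re_q e v].

(* e'' is the Baer sum of e and e': there is a morphism h from the fibre      *)
(* product of e and e' over B to e'' inducing the addition on A + A and the   *)
(* identity on B.                                                             *)
Definition rep_baer (B A : repr) (e e' e'' : repExt B A) : Prop :=
  exists h : e -> e' -> e'',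
  let fib (v : e) (v' : e') := re_q e v = re_q e' v' in
  [/\ forall a u u' v v', fib u u' -> fib v v' ->
        h (a *: u + v) (a *: u' + v') = a *: h u u' + h v v',
      forall g v v', g \in unitmx -> fib v v' ->
        h (rep_act g v) (rep_act g v') = rep_act g (h v v'),
      forall r, rep_cs e'' r -> exists q q', [/\ rep_cs e q, rep_cs e' q'
        & forall v v', fib v v' -> r (h v v') <= Num.max (q v) (q' v')],
      forall x x', h (re_i e x) (re_i e' x') = re_i e'' (x + x')
    & forall v v', fib v v' -> re_q e'' (h v v') = re_q e v].

(* The Yoneda group Ext^1(B, A), as a finite dimensional vector space X with  *)
(* the map sending an extension to its class.  Scaling by 1 is isomorphism of *)
(* extensions, so X is determined up to a unique isomorphism.                 *)
Record repExtSpace (B A : repr) := RepExtSpace {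
  rx_space :> vectType E;
  rx_cl : repExt B A -> rx_space;
  rx_surj : forall x, exists e, rx_cl e = x;
  rx_scale : forall a e e', rx_cl e' = a *: rx_cl e <-> rep_scaled a e e';
  rx_add : forall e e' e'', rx_cl e'' = rx_cl e + rx_cl e' <-> rep_baer e e' e''
}.

(* The tautological extension of B (x) W by A, for W in Ext^1(B, A): the      *)
(* amalgamated sum along A of extensions te_e k whose classes form a basis of *)
(* W.  te_q k is the k-th coordinate of the projection onto B (x) W in this   *)
(* basis; it is determined by the two last fields.                            *)
Record tautExt (B A : repr) (X : repExtSpace B A) (W : {vspace X}) := TautExt {
  te_rep :> repr;
  te_b : (\dim W).-tuple X;
  te_e : 'I_(\dim W) -> repExt B A;
  te_i : A -> te_rep;
  te_u : forall k, te_e k -> te_rep;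
  te_q : 'I_(\dim W) -> te_rep -> B;
  te_basis : basis_of W te_b;
  te_class : forall k, rx_cl X (te_e k) = tnth te_b k;
  te_top : top_rep te_rep;
  te_imor : rep_mor te_i;
  te_umor : forall k, rep_mor (@te_u k);
  te_glue : forall k x, te_u (re_i (te_e k) x) = te_i x;
  te_surj : forall v, exists x (y : forall k, te_e k),
    v = te_i x + \sum_k te_u (y k);
  te_ker : forall x (y : forall k, te_e k), te_i x + \sum_k te_u (y k) = 0 ->
    exists z : 'I_(\dim W) -> A,
      (forall k, y k = re_i (te_e k) (z k)) /\ x + \sum_k z k = 0;
  te_final : forall r, seminorm r -> rep_cs A (fun x => r (te_i x)) ->
    (forall k, rep_cs (te_e k) (fun y => r (te_u y))) -> rep_cs te_rep r;
  te_qlin : forall k, linear (te_q k);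
  te_qi : forall k x, te_q k (te_i x) = 0;
  te_qu : forall k l (y : te_e l),
    te_q k (te_u y) = if k == l then re_q (te_e l) y else 0
}.

(* The composite of the projection onto B (x) W with id (x) l, for a linear   *)
(* form l (only its values on W matter).                                      *)
Definition te_form (B A : repr) (X : repExtSpace B A) (W : {vspace X})
    (T : tautExt W) (l : 'Hom(X, E^o)) (v : T) : B :=
  \sum_k (l (tnth (te_b T) k) : E) *: te_q k v.

(* For W' in W: the embedding of the tautological extension of B (x) W' into  *)
(* that of B (x) W, over A and over the inclusion of B (x) W' in B (x) W.     *)
Definition te_incl (B A : repr) (X : repExtSpace B A) (W' W : {vspace X})
    (T' : tautExt W') (T : tautExt W) (f : T' -> T) : Prop :=
  [/\ strict_embedding f, forall x, f (te_i T' x) = te_i T x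
    & forall (l : 'Hom(X, E^o)) v, te_form l (f v) = te_form l v].

(******************************************************************************)
(*                        Induced representations                             *)
(******************************************************************************)

(* Locally analytic induction from B^- of the representation rho of B^- on a  *)
(* finite dimensional normed space F: functions f on GL_n(Q_p) (extended by   *)
(* 0) with f(b g) = rho(b) f(g), with GL_n(Q_p) acting by right translation.  *)
Section Induction.
Context (F : lmodType E) (N : F -> R) (HN : seminorm N).
Context (rho : 'M[K]_n -> F -> F).
Context (Hrho : forall b, linear (rho b)).

Definition ind_an (f : 'M[K]_n -> F) : Prop :=
  [/\ forall g, g \notin unitmx -> f g = 0,
      forall g, g \in unitmx -> exists m c,
        analytic N m (fun x => f (chart g x)) c
    & forall b g, lower_borel b -> g \in unitmx -> f (b *m g) = rho b (f g)].

Lemma ind_an_subspace : subspace_prop ind_an.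
Proof.
have rho0 b : rho b 0 = 0.
  by have := Hrho b (-1) 0 0; rewrite scaler0 addr0 scaleN1r addNr.
split.
  split=> [//|g _|b g _ _]; last by rewrite rho0.
  by exists 0%N, (fun=> 0); exact: analytic0.
move=> a u v [u0 ula uB] [v0 vla vB]; split=> [g g0|g gU|b g bB gU].
- by rewrite !fctE u0 // v0 // scaler0 addr0.
- have [m [c h]] := ula g gU; have [m' [c' h']] := vla g gU.
  by do 2!eexists; exact: (analytic_lin a HN h h').
by rewrite !fctE uB // vB // Hrho.
Qed.

Definition ind_an_space := sublmod ind_an_subspace.
HB.instance Definition _ := GRing.Lmodule.on ind_an_space.

Definition ind_fun (f : ind_an_space) : 'M[K]_n -> F := sublmod_val f.

Definition rtrans (h : 'M[K]_n) (f : 'M[K]_n -> F) : 'M[K]_n -> F :=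
  fun g => if h \in unitmx then f (g *m h) else 0.

Lemma ind_an_act_subproof (h : 'M[K]_n) (f : ind_an_space) :
  rtrans h (ind_fun f) \in sublmod_pred ind_an_subspace.
Proof.
apply/asboolP; have [f0 fla fB] := sublmodP f.
rewrite /rtrans /ind_fun; have [hU|hU] := boolP (h \in unitmx); last first.
  exact: ind_an_subspace.1.
split=> [g g0|g gU|b g bB gU].
- by rewrite f0 // unitmx_mul (negPf g0).
- have [|m [c hc]] := fla (g *m h); first by rewrite unitmx_mul gU.
  exists m, c; congr (analytic _ _ _ _): hc.
  by apply/funext => x; rewrite /chart mulmxA.
by rewrite -mulmxA fB // unitmx_mul gU.
Qed.

Definition ind_an_act (h : 'M[K]_n) (f : ind_an_space) : ind_an_space :=
  SubLmod (ind_an_act_subproof h f).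

(* Restriction to GL_n(Z_p) identifies the induction with a closed subspace   *)
(* of the inductive limit over m of the Banach spaces of functions which are  *)
(* rigid analytic on all cosets (1 + p^m M_n(Z_p)) g, with the topology       *)
(* induced by this inductive limit.                                           *)
Definition ind_an_cs (q : ind_an_space -> R) : Prop :=
  seminorm q /\ forall m : nat, (0 < m)%N -> exists C : R,
    forall (f : ind_an_space) (k : R),
      (forall g, glZp g -> exists2 c,
         analytic N m (fun x => (ind_fun f) (chart g x)) c
         & coef_le N m c k) ->
      q f <= C * k.

Definition ind_an_rep : repr := @Rep R p K E n _ ind_an_cs ind_an_act.

End Induction.

(* The character (t_i) |-> \prod_i chi i (t_i) of the torus, on B^-.          *)
Definition bchar (chi : 'I_n -> K -> E) (b : 'M[K]_n) : E :=
  \prod_i chi i (b i i).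

Definition badd (psi : homT E n) (b : 'M[K]_n) : E :=
  \sum_i (sublmod_val (psi i) : K -> E^o) (b i i).

(* chi, on E.                                                                 *)
Definition rho1 (chi : 'I_n -> K -> E) (b : 'M[K]_n) (x : E^o) : E^o :=
  bchar chi b * x.

Lemma rho1_lin chi b : linear (rho1 chi b).
Proof. by move=> a u v; rewrite /rho1 mulrDr; congr (_ + _); exact: mulrCA. Qed.

(* chi (1 + psi epsilon), on E[epsilon] = E + E epsilon.                      *)
Definition dual_num := (E^o * E^o)%type.
HB.instance Definition _ := GRing.Lmodule.on dual_num.

Definition rho2 (chi : 'I_n -> K -> E) (psi : homT E n) (b : 'M[K]_n)
    (x : dual_num) : dual_num :=
  (bchar chi b * x.1, bchar chi b * (x.2 + badd psi b * x.1)).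

Lemma rho2_lin chi psi b : linear (rho2 chi psi b).
Proof.
move=> a u v; rewrite /rho2; congr (_, _) => /=.
  by rewrite mulrDr; congr (_ + _); exact: mulrCA.
set c := bchar chi b; set d := badd psi b; case: u v => [u1 u2] [v1 v2] /=.
have -> : d * (a *: u1 + v1) = a *: (d * u1 : E^o) + d * v1.
  by rewrite mulrDr; congr (_ + _); exact: mulrCA.
rewrite addrACA -scalerDr mulrDr; congr (_ + _); exact: mulrCA.
Qed.

Definition nrm_dual (x : dual_num) : R := Num.max (nrm x.1) (nrm x.2).

Lemma nrm_dual_seminorm : seminorm nrm_dual.
Proof.
split=> [v|a v|u v].
- by rewrite le_max nrm_ge0.
- by rewrite /nrm_dual /= !nrmM maxr_pMr // nrm_ge0.
rewrite /nrm_dual /= ge_max.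
by apply/andP; split; apply: le_trans (nrmD _ _) _;
  rewrite ge_max !le_max !lexx ?orbT.
Qed.

(* (Ind chi)^an and (Ind chi (1 + psi epsilon))^an.                           *)
Definition ind1 (chi : 'I_n -> K -> E) : repr :=
  ind_an_rep (nrm_seminorm E) (rho1_lin chi).

Definition ind2 (chi : 'I_n -> K -> E) (psi : homT E n) : repr :=
  ind_an_rep nrm_dual_seminorm (rho2_lin chi psi).

(* Unnormalized smooth induction (Ind chi)^oo from B^-: locally constant      *)
(* functions f on GL_n(Q_p) (extended by 0) with f(b g) = chi(b) f(g).        *)
Section SmoothInduction.
Context (chi : 'I_n -> K -> E).

Definition ind_sm (f : 'M[K]_n -> E^o) : Prop :=
  [/\ forall g, g \notin unitmx -> f g = 0,
      forall g, g \in unitmx -> exists m : nat, forall x,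
        (forall ij, vge m%:Z (x ij)) -> f (chart g x) = f g
    & forall b g, lower_borel b -> g \in unitmx ->
        f (b *m g) = bchar chi b * f g].

Lemma ind_sm_subspace : subspace_prop ind_sm.
Proof.
split.
  by split=> [//|g _|b g _ _]; [exists 0%N | apply/esym/mulr0].
move=> a u v [u0 ulc uB] [v0 vlc vB]; split=> [g g0|g gU|b g bB gU].
- by rewrite !fctE u0 // v0 // scaler0 addr0.
- have [m hm] := ulc g gU; have [m' hm'] := vlc g gU.
  have vw (i j : nat) (y : K) : (i <= j)%N -> vge j%:Z y -> vge i%:Z y.
    move=> lij /orP[y0|jy]; first by rewrite /vge y0.
    by rewrite /vge (le_trans _ jy) ?orbT // lez_nat.
  exists (maxn m m') => x hx; rewrite !fctE hm ?hm' // => ij.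
    exact: vw (leq_maxr m m') (hx ij).
  exact: vw (leq_maxl m m') (hx ij).
rewrite !fctE uB // vB // mulrDr; congr (_ + _); exact: mulrCA.
Qed.

Definition ind_sm_space := sublmod ind_sm_subspace.
HB.instance Definition _ := GRing.Lmodule.on ind_sm_space.

Lemma ind_sm_act_subproof (h : 'M[K]_n) (f : ind_sm_space) :
  rtrans h (sublmod_val f : 'M[K]_n -> E^o) \in sublmod_pred ind_sm_subspace.
Proof.
apply/asboolP; have [f0 flc fB] := sublmodP f.
rewrite /rtrans; have [hU|hU] := boolP (h \in unitmx); last first.
  exact: ind_sm_subspace.1.
split=> [g g0|g gU|b g bB gU].
- by rewrite f0 // unitmx_mul (negPf g0).
- have [|m hm] := flc (g *m h); first by rewrite unitmx_mul gU.
  by exists m => x hx; rewrite /chart -mulmxA hm.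
by rewrite -mulmxA fB // unitmx_mul gU.
Qed.

Definition ind_sm_act (h : 'M[K]_n) (f : ind_sm_space) : ind_sm_space :=
  SubLmod (ind_sm_act_subproof h f).

End SmoothInduction.

(******************************************************************************)
(*      Algebraic representations and locally algebraic representations       *)
(******************************************************************************)

(* L is the irreducible algebraic representation of GL_n of highest weight mu *)
(* (with respect to the upper triangular Borel).                              *)
Definition alg_rep_hw (L : vectType E) (act : 'M[K]_n -> L -> L)
    (mu : 'I_n -> int) : Prop :=
  [/\ [/\ forall g, g \in unitmx -> linear (act g), forall v, act 1%:M v = v
        & forall g h v, g \in unitmx -> h \in unitmx ->
            act (g *m h) v = act g (act h v)],
      (* matrix coefficients are polynomials in the entries and 1 / det *)
      forall v, exists (d M : nat) (c : {ffun idx -> nat} -> L), forall g,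
        g \in unitmx ->
        (\det g ^+ d)%:A *: act g v = psum c (fun ij => g ij.1 ij.2) M,
      (exists v : L, v != 0) /\
      (forall U : {vspace L}, U != 0%VS ->
         (forall g v, g \in unitmx -> v \in U -> act g v \in U) -> U = fullv)
    & exists2 v, v != 0 &
      (forall g, is_trig_mx g^T -> (forall i, g i i = 1) -> act g v = v) /\
      (forall t : 'rV[K]_n, (forall i, t 0 i != 0) ->
         act (diag_mx t) v = (\prod_i t 0 i ^ mu i)%:A *: v)].

(* tau : U x W -> T is a tensor product of U and W over E.                    *)
Definition bilin (U W T : lmodType E) (tau : U -> W -> T) : Prop :=
  (forall u, linear (tau u)) /\ (forall w, linear (tau ^~ w)).

Definition is_tensor (U W T : lmodType E) (tau : U -> W -> T) : Prop :=
  bilin tau /\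
  forall (Z : lmodType E) (beta : U -> W -> Z), bilin beta ->
    exists f : {linear T -> Z}, (forall u w, f (tau u w) = beta u w) /\
      forall f' : {linear T -> Z}, (forall u w, f' (tau u w) = beta u w) ->
        f =1 f'.

End Reps.
Arguments re_i {R p K E n B A} _ _.
Arguments re_q {R p K E n B A} _ _.

(******************************************************************************)
(*                     The representation pi(alpha, h)                        *)
(******************************************************************************)

Section AutomorphicSide.
Context (R : realType) (p : nat) (K : padicField p) (E : coefField R K).
Context (n : nat) (alpha : 'I_n -> E) (h : 'I_n -> int).

Local Notation repr := (rep E n).

(* Indices start at 0, so that theta_i = - i.                                 *)

(* unr(w(alpha)) z^h (epsilon^-1 o theta)                                     *)
Definition ps_char (w : 'S_n) (i : 'I_n) (x : K) : E :=
  unrz (alpha ((w^-1)%g i)) (h i) x * cyclo E x ^+ i.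

Definition PS (w : 'S_n) : repr := ind1 (ps_char w).

(* The deformation (Ind unr(w(alpha)) z^h (epsilon^-1 o theta)(1 + psi eps)). *)
Definition PSeps (w : 'S_n) (psi : homT E n) : repr := ind2 (ps_char w) psi.

(* The quotient map PSeps -> PS and the functions with values in E epsilon.   *)
Definition eps_proj (w : 'S_n) (psi : homT E n) (F : PSeps w psi) (f : PS w) :=
  forall g, (ind_fun F g).1 = ind_fun f g.

Definition eps_sub (w : 'S_n) (psi : homT E n) (f : PS w) (F : PSeps w psi) :=
  forall g, ind_fun F g = (0, ind_fun f g).

(* unr(alpha) eta                                                             *)
Definition sm_char (i : 'I_n) (x : K) : E := unrz (alpha i) 0 x * absE E x ^+ i.

Record autData := AutData {
  (* pi_alg = pi_sm (x) L(h - theta), with its finest locally convex topology *)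
  aL : vectType E;
  aL_act : 'M[K]_n -> aL -> aL;
  aL_hw : alg_rep_hw aL_act (fun i => h i + (i : nat)%:Z);
  palg : repr;
  ptau : ind_sm_space sm_char -> aL -> palg;
  ptau_tensor : is_tensor ptau;
  ptau_act : forall g f v, g \in unitmx ->
    rep_act g (ptau f v) = ptau (ind_sm_act g f) (aL_act g v);
  palg_cs : forall q, rep_cs palg q <-> seminorm q;
  palg_top : top_rep palg;
  (* the fixed embeddings of pi_alg *)
  iota : forall w : 'S_n, palg -> PS w;
  iota_mor : forall w, rep_mor (iota w);
  iota_inj : forall w, injective (iota w);
  (* pi(alpha, h): quotient of the amalgamated sum of the PS w along pi_alg,  *)
  (* with socle pi_alg                                                        *)
  pirep : repr;
  pi_adm : admissible pirep;
  jps : forall w : 'S_n, PS w -> pirep;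
  jps_mor : forall w, rep_mor (@jps w);
  jalg : palg -> pirep;
  jalg_inj : injective jalg;
  jps_glue : forall w v, jps (iota w v) = jalg v;
  jps_surj : forall x, exists f : forall w, PS w, x = \sum_w jps (f w);
  jps_final : forall r, seminorm r ->
    (forall w, rep_cs (PS w) (fun f => r (jps f))) -> rep_cs pirep r;
  pi_socle : forall x, socle x <-> exists v, x = jalg v
}.

Arguments iota _ _ _ : clear implicits.
Arguments jps _ _ _ : clear implicits.
Arguments jalg _ _ : clear implicits.

Context (A : autData).

(* e is the pull-back along iota of the push-forward along jps of the self-   *)
(* extension PSeps w psi of PS w: there is a morphism k to e from the fibre   *)
(* product of PSeps w psi and pi_alg over PS w, inducing jps on PS w and the  *)
(* identity on pi_alg.                                                        *)
Definition zeta_ext (w : 'S_n) (psi : homT E n) (e : repExt (palg A) (pirep A))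
  : Prop :=
  exists k : PSeps w psi -> palg A -> e,
  let fib F v := eps_proj F (iota A w v) in
  [/\ forall a F F' v v', fib F v -> fib F' v' ->
        k (a *: F + F') (a *: v + v') = a *: k F v + k F' v',
      forall g F v, g \in unitmx -> fib F v ->
        k (rep_act g F) (rep_act g v) = rep_act g (k F v),
      forall r, rep_cs e r -> exists q q',
        [/\ rep_cs (PSeps w psi) q, rep_cs (palg A) q'
          & forall F v, fib F v -> r (k F v) <= Num.max (q F) (q' v)],
      forall f F, eps_sub f F -> k F 0 = re_i e (jps A w f)
    & forall F v, fib F v -> re_q e (k F v) = v].

Context (X : repExtSpace (palg A) (pirep A)).

(* zeta_w, its image Ext^1_w, and its injectivity.                            *)
Record zetaData := ZetaData {
  zeta : 'S_n -> {linear homT E n -> X};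
  zetaP : forall w psi e, rx_cl X e = zeta w psi <-> zeta_ext w psi e;
  zeta_inj : forall w, injective (zeta w);
  extA : 'S_n -> {vspace X};
  extAP : forall w x, x \in extA w <-> exists psi, x = zeta w psi
}.

End AutomorphicSide.
Arguments iota {R p K E n alpha h} _ _ _.
Arguments jps {R p K E n alpha h} _ _ _.
Arguments jalg {R p K E n alpha h} _ _.

(******************************************************************************)
(*                            The Robba ring                                  *)
(******************************************************************************)

Section Robba.
Context (R : realType) (p : nat) (K : padicField p) (E : coefField R K).

(* The Laurent series a converges on the annulus r < |X| < 1.                 *)
Definition annular (r : R) (a : int -> E) : Prop :=
  forall s : R, r < s < 1 -> forall e : R, 0 < e ->
    exists m : nat, forall i : int, (m <= `|i|)%N -> nrm (a i) * s ^ i < e.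

(* Continuous seminorms, for the coefficient map c, for the locally convex    *)
(* inductive limit topology of the Frechet spaces of Laurent series           *)
(* converging on r < |X| < 1, for r < 1.  The norm of index s is              *)
(* sup_i |a_i| s^i.                                                           *)
Definition robba_cs (V : lmodType E) (c : V -> int -> E) (q : V -> R) : Prop :=
  seminorm q /\ forall r : R, 0 < r < 1 -> exists s1 s2 C : R,
    [/\ r < s1 < 1, r < s2 < 1
      & forall f k, annular r (c f) ->
          (forall i, nrm (c f i) * s1 ^ i <= k /\ nrm (c f i) * s2 ^ i <= k) ->
          q f <= C * k].

(* Binomial coefficient a (a - 1) ... (a - k + 1) / k!                        *)
Definition binE (a : K) (k : nat) : E :=
  (\prod_(i < k) (a - i%:R))%:A / k`!%:R.

(* The Robba ring of Q_p over E with its Frobenius and the action of          *)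
(* Gamma = Z_p^x, up to unique isomorphism: the ring of all Laurent series    *)
(* converging on some annulus r < |X| < 1, with phi and the gamma_a the       *)
(* continuous E-algebra endomorphisms such that phi(1 + X) = (1 + X)^p and    *)
(* gamma_a(1 + X) = (1 + X)^a.                                                *)
Structure robba := Robba {
  rob :> comAlgType E;
  rcoef : rob -> int -> E;
  rcoefP : forall a : int -> E,
    (exists f, rcoef f =1 a) <-> (exists2 r : R, r < 1 & annular r a);
  rcoef_inj : forall f g, rcoef f =1 rcoef g -> f = g;
  rcoef_lin : forall (a : E) f g k,
    rcoef (a *: f + g) k = a * rcoef f k + rcoef g k;
  rcoef1 : forall k, rcoef 1 k = (k == 0)%:R;
  rcoefM : forall f g k (e : R), 0 < e -> exists m0 : nat, forall m : nat,
    (m0 <= m)%N ->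
    nrm (rcoef (f * g) k
         - \sum_(i < m.*2.+1) rcoef f (i%:Z - m%:Z) * rcoef g (k - i%:Z + m%:Z))
    < e;
  robX : rob;
  rcoefX : forall k, rcoef robX k = (k == 1)%:R;
  rphi : rob -> rob;
  rphi_lin : linear rphi;
  rphi1 : rphi 1 = 1;
  rphiM : forall f g, rphi (f * g) = rphi f * rphi g;
  rphi_cont : forall q, robba_cs rcoef q -> robba_cs rcoef (fun f => q (rphi f));
  rphiX : rphi (1 + robX) = (1 + robX) ^+ p;
  rgam : K -> rob -> rob;
  rgam_lin : forall a, zpunit a -> linear (rgam a);
  rgam1 : forall a, zpunit a -> rgam a 1 = 1;
  rgamM : forall a f g, zpunit a -> rgam a (f * g) = rgam a f * rgam a g;
  rgam_cont : forall a q, zpunit a ->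
    robba_cs rcoef q -> robba_cs rcoef (fun f => q (rgam a f));
  rgamX : forall a k, zpunit a -> rcoef (rgam a (1 + robX)) k =
    if k is Posz j then binE a j else 0
}.

End Robba.
Arguments robX {R p K E} _.

(******************************************************************************)
(*                          (phi, Gamma)-modules                              *)
(******************************************************************************)

Section PhiGamma.
Context (R : realType) (p : nat) (K : padicField p) (E : coefField R K).
Context (Rob : robba E).

(* Raw data; pg_gam a is only meaningful for a in Gamma = Z_p^x.              *)
Structure pgdata := PgData {
  pg_mod :> lmodType Rob;
  pg_phi : pg_mod -> pg_mod;
  pg_gam : K -> pg_mod -> pg_mod
}.

Definition rbasis (M : lmodType Rob) (d : nat) (b : 'I_d -> M) : Prop :=
  forall v, exists! c : {ffun 'I_d -> Rob}, v = \sum_i c i *: b i.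

(* Continuous seminorms for the product topology on a finite free module.     *)
Definition pg_cs (M : lmodType Rob) (q : M -> R) : Prop :=
  [/\ forall v, 0 <= q v, forall u v, q (u + v) <= Num.max (q u) (q v)
    & forall v, robba_cs (@rcoef _ _ _ _ Rob) (fun f => q (f *: v))].

(* (phi, Gamma)-modules of rank d over the Robba ring.                        *)
Definition is_pgmod (d : nat) (D : pgdata) : Prop :=
  [/\ exists b : 'I_d -> D, rbasis b /\ rbasis (fun i => pg_phi (b i)),
      [/\ forall u v : D, pg_phi (u + v) = pg_phi u + pg_phi v
        & forall f (v : D), pg_phi (f *: v) = rphi f *: pg_phi v],
      [/\ forall a (u v : D), zpunit a -> pg_gam a (u + v) = pg_gam a u + pg_gam a v,
          forall a f (v : D), zpunit a -> pg_gam a (f *: v) = rgam a f *: pg_gam a v,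
          forall v : D, pg_gam 1 v = v
        & forall a b (v : D), zpunit a -> zpunit b ->
            pg_gam (a * b) v = pg_gam a (pg_gam b v)],
      forall a (v : D), zpunit a -> pg_phi (pg_gam a v) = pg_gam a (pg_phi v)
    & (* continuity of the action of Gamma *)
      forall (v : D) q a (e : R), pg_cs q -> zpunit a -> 0 < e ->
        exists m : int, forall b, zpunit b -> vge m (b - a) ->
          q (pg_gam b v - pg_gam a v) < e].

(* phi- and Gamma-equivariant maps.                                           *)
Definition pg_mor (D D' : pgdata) (f : D -> D') : Prop :=
  [/\ linear f, forall v, f (pg_phi v) = pg_phi (f v)
    & forall a v, zpunit a -> f (pg_gam a v) = pg_gam a (f v)].

Definition pg_sub (D : pgdata) (U : D -> Prop) : Prop :=
  [/\ U 0, forall (f : Rob) u v, U u -> U v -> U (f *: u + v),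
      forall v, U v -> U (pg_phi v)
    & forall a v, zpunit a -> U v -> U (pg_gam a v)].

(******************************************************************************)
(*      Crystalline modules, Hodge-Tate weights, non-criticality              *)
(******************************************************************************)

(* With t = log(1 + X), gamma_a(t) = a t and phi(t) = p t: this says that     *)
(* t^(-k) v is in D_cris(D) = D[1/t]^Gamma.                                   *)
Definition in_cris (D : pgdata) (k : nat) (v : D) : Prop :=
  forall a, zpunit a -> pg_gam a v = ((a ^+ k)%:A : E)%:A *: v.

Definition E_free (D : pgdata) (d : nat) (v : 'I_d -> D) : Prop :=
  forall c : 'I_d -> E, \sum_i (c i)%:A *: v i = 0 -> forall i, c i = 0.

(* phi^(m-1) of the p-th cyclotomic polynomial in 1 + X; its roots are the    *)
(* zeta - 1, zeta a primitive p^m-th root of unity, which are simple zeros of *)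
(* t.                                                                         *)
Definition cyc (m : nat) : Rob := \sum_(j < p) (1 + robX Rob) ^+ (j * p ^ m.-1).

(* t^(-k) v (in D_cris) lies in Fil^i D_cris = D_cris \cap t^i D_dif^+.       *)
(* D_cris embeds into D_dif by iota_m o phi^m for any large m, where iota_m   *)
(* is the localization at the zeros of cyc m, and divisibility by t in        *)
(* D_dif^+ is divisibility by cyc m there.  It is tested on coordinates in a  *)
(* basis b (the choice of b is irrelevant for large m), as functions on an    *)
(* annulus r < |X| < 1 containing the zeros of cyc m, which have absolute     *)
(* value p^(- 1 / ((p - 1) p^(m - 1))).                                       *)
Definition in_fil (D : pgdata) (d k : nat) (i : int) (v : D) : Prop :=
  exists2 b : 'I_d -> D, rbasis b & exists m0 : nat, forall m : nat,
    (m0 <= m)%N -> exists (r : R) (c : 'I_d -> Rob),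
    [/\ 0 < r < 1 /\ r ^+ (p.-1 * p ^ m.-1) < p%:R^-1,
        forall l, annular r (rcoef (c l))
      & iter m (@pg_phi D) v =
          \sum_l (cyc m ^+ `|Num.max 0 (i + k%:Z)| * c l) *: b l].

Section NonCritical.
Context (n : nat) (alpha : 'I_n -> E) (h : 'I_n -> int) (D : pgdata).

(* D is crystalline: dim D_cris(D) = n; as the alpha_i are distinct, phi has  *)
(* eigenvalues alpha on D_cris(D) iff it has a basis of such eigenvectors.    *)
Definition crystalline_eig : Prop :=
  exists (k : nat) (v : 'I_n -> D),
    [/\ forall j, in_cris k (v j), E_free v
      & forall j, pg_phi (v j) = (p%:R ^+ k * alpha j)%:A *: v j].

(* The jumps of the filtration of D_cris(D) are the - h_j (the cyclotomic     *)
(* character has weight 1): there is a basis of D_cris(D) such that Fil^i is  *)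
(* spanned by the vectors with - h_j >= i.                                    *)
Definition ht_weights : Prop :=
  exists (k : nat) (v : 'I_n -> D),
    [/\ forall j, in_cris k (v j), E_free v
      & forall (i : int) (c : 'I_n -> E),
          in_fil n k i (\sum_j (c j)%:A *: v j) <->
          (forall j, ~~ (i <= - h j) -> c j = 0)].

(* G / F is isomorphic to Rob(delta).                                         *)
Definition rank1_step (F G : D -> Prop) (delta : K -> E) : Prop :=
  exists e : D,
    [/\ forall v, G v <-> exists f : Rob, F (v - f *: e),
        forall f : Rob, F (f *: e) -> f = 0,
        F (pg_phi e - (delta p%:R)%:A *: e)
      & forall a, zpunit a -> F (pg_gam a e - (delta a)%:A *: e)].

Definition triangulation (delta : 'I_n -> K -> E) : Prop :=
  exists F : nat -> D -> Prop,
    [/\ forall i, pg_sub (F i),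
        forall i (f : Rob) v, f != 0 -> F i (f *: v) -> F i v,
        forall v, F 0%N v <-> v = 0, forall v, F n v
      & forall i : 'I_n, rank1_step (F i) (F i.+1) (delta i)].

Definition noncrit_char (w : 'S_n) (i : 'I_n) : K -> E :=
  unrz (alpha ((w^-1)%g i)) (h i).

(* Membership in Phi Gamma_nc(alpha, h).                                      *)
Definition noncritical_crystalline : Prop :=
  [/\ is_pgmod n D, crystalline_eig, ht_weights
    & forall w, triangulation (noncrit_char w)].

End NonCritical.

(******************************************************************************)
(*                  Extensions and deformations of D                          *)
(******************************************************************************)

Record pgExt (D : pgdata) := PgExt {
  pe_mid :> pgdata;
  pe_i : D -> pe_mid;
  pe_q : pe_mid -> D;
  pe_pg : exists d, is_pgmod d pe_mid;
  pe_imor : pg_mor pe_i;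
  pe_qmor : pg_mor pe_q;
  pe_inj : injective pe_i;
  pe_surj : forall x, exists v, pe_q v = x;
  pe_exact : forall v, pe_q v = 0 <-> exists x, v = pe_i x
}.
Arguments pe_i {D} _ _.
Arguments pe_q {D} _ _.

(* As rep_scaled, rep_baer and repExtSpace above.                             *)
Definition pg_scaled (D : pgdata) (a : E) (e e' : pgExt D) : Prop :=
  exists f : e -> e', [/\ pg_mor f,
    forall x, f (pe_i e x) = pe_i e' (a%:A *: x)
    & forall v, pe_q e' (f v) = pe_q e v].

Definition pg_baer (D : pgdata) (e e' e'' : pgExt D) : Prop :=
  exists h : e -> e' -> e'',
  let fib (v : e) (v' : e') := pe_q e v = pe_q e' v' in
  [/\ forall (f : Rob) u u' v v', fib u u' -> fib v v' ->
        h (f *: u + v) (f *: u' + v') = f *: h u u' + h v v',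
      forall v v', fib v v' -> h (pg_phi v) (pg_phi v') = pg_phi (h v v'),
      forall a v v', zpunit a -> fib v v' ->
        h (pg_gam a v) (pg_gam a v') = pg_gam a (h v v'),
      forall x x', h (pe_i e x) (pe_i e' x') = pe_i e'' (x + x')
    & forall v v', fib v v' -> pe_q e'' (h v v') = pe_q e v].

Record pgExtSpace (D : pgdata) := PgExtSpace {
  px_space :> vectType E;
  px_cl : pgExt D -> px_space;
  px_surj : forall x, exists e, px_cl e = x;
  px_scale : forall a e e', px_cl e' = a *: px_cl e <-> pg_scaled a e e';
  px_add : forall e e' e'', px_cl e'' = px_cl e + px_cl e' <-> pg_baer e e' e''
}.

(* An extension e of D by D is a deformation of D over E[epsilon], where      *)
(* epsilon acts by pe_i e o pe_q e.                                           *)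
Definition eps (D : pgdata) (e : pgExt D) (v : e) : e := pe_i e (pe_q e v).

Section Deformations.
Context (n : nat) (alpha : 'I_n -> E) (h : 'I_n -> int) (D : pgdata).

(* G / F is isomorphic to Rob_{E[epsilon]}(delta (1 + psi epsilon)).          *)
Definition rank1_eps_step (e : pgExt D) (F G : e -> Prop)
    (delta : K -> E) (psi : laHom E) : Prop :=
  exists b : e,
  let tw (a : K) := (delta a)%:A *: (b + (sublmod_val psi a : E)%:A *: eps b) in
    [/\ forall v, G v <-> exists f f' : Rob, F (v - (f *: b + f' *: eps b)),
        forall f f' : Rob, F (f *: b + f' *: eps b) -> f = 0 /\ f' = 0,
        F (pg_phi b - tw p%:R)
      & forall a, zpunit a -> F (pg_gam a b - tw a)].

(* e is a successive extension of the                                         *)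
(* Rob_{E[epsilon]}(unr(alpha_{w^-1(i)}) z^{h_i} (1 + psi_i epsilon)).        *)
Definition triangular_def (w : 'S_n) (psi : homT E n) (e : pgExt D) : Prop :=
  exists F : nat -> e -> Prop,
    [/\ forall i, pg_sub (F i), forall i v, F i v -> F i (eps v),
        forall v, F 0%N v <-> v = 0, forall v, F n v
      & forall i : 'I_n,
          rank1_eps_step (F i) (F i.+1) (noncrit_char alpha h w i) (psi i)].

Context (X : pgExtSpace D).

(* The subspaces Ext^1_w(D, D), the maps kappa_w (which are well-defined,     *)
(* linear and surjective) and their common kernel Ext^1_0(D, D).              *)
Record kappaData := KappaData {
  extG : 'S_n -> {vspace X};
  kappa : forall w, {linear subvs_of (extG w) -> homT E n};
  extGP : forall w e, px_cl X e \in extG w <-> exists psi, triangular_def w psi e;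
  kappaP : forall w (x : subvs_of (extG w)) e psi, px_cl X e = vsval x ->
    (triangular_def w psi e <-> kappa w x = psi);
  kappa_surj : forall w psi, exists x, kappa w x = psi;
  extG0 : {vspace X};
  extG0P : forall w x,
    x \in extG0 <-> exists2 y, vsval y = x & kappa w y = 0
}.

End Deformations.
End PhiGamma.
Arguments pe_i {R p K E Rob D} _ _.
Arguments pe_q {R p K E Rob D} _ _.

(******************************************************************************)
(*                    Trivial square-zero extensions of E                     *)
(******************************************************************************)

(* The local Artinian E-algebra E + U^dual, with U^dual of square zero.       *)
Section SquareZero.
Context (F : fieldType) (U : vectType F).

Definition sqz := (F^o * 'Hom(U, F^o))%type.
HB.instance Definition _ := GRing.Lmodule.on sqz.

Definition sqz_one : sqz := (1, 0).
Definition sqz_mul (a b : sqz) : sqz :=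
  (a.1 * b.1, (a.1 : F) *: b.2 + (b.1 : F) *: a.2).

Lemma sqz_mulA : associative sqz_mul.
Proof.
move=> [a x] [b y] [c z]; congr (_, _) => /=; first exact: mulrA.
by rewrite !scalerDr !scalerA -addrA (mulrC c a) (mulrC c b).
Qed.

Lemma sqz_mulC : commutative sqz_mul.
Proof. by move=> a b; rewrite /sqz_mul mulrC addrC. Qed.

Lemma sqz_mul1 : left_id sqz_one sqz_mul.
Proof. by move=> [a x]; rewrite /sqz_mul /= mul1r scale1r scaler0 addr0. Qed.

Lemma sqz_mulD : left_distributive sqz_mul +%R.
Proof.
move=> [a x] [b y] [c z]; congr (_, _) => /=; first exact: mulrDl.
by rewrite scalerDl scalerDr addrACA.
Qed.

Lemma sqz_one_neq0 : sqz_one != 0.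
Proof. by apply/eqP => -[] /eqP; rewrite oner_eq0. Qed.

HB.instance Definition _ := GRing.Zmodule_isComNzRing.Build sqz
  sqz_mulA sqz_mulC sqz_mul1 sqz_mulD sqz_one_neq0.

Lemma sqz_scaleAl (k : F) (a b : sqz) : k *: (a * b) = (k *: a) * b.
Proof.
case: a b => [a x] [b y]; congr (_, _) => /=; first exact: mulrA.
by rewrite scalerDr !scalerA (mulrC b).
Qed.

HB.instance Definition _ := GRing.Lmodule_isLalgebra.Build F sqz sqz_scaleAl.
HB.instance Definition _ := GRing.Lalgebra_isComAlgebra.Build F sqz.

(* The maximal ideal.                                                         *)
Definition sqz_max (a : sqz) : Prop := a.1 = 0.

End SquareZero.

(* The quotient map E + U^dual -> E + W^dual, for a subspace W of U.          *)
Definition sqz_res (F : fieldType) (U : vectType F) (W : {vspace U})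
    (a : sqz U) : sqz (subvs_of W) :=
  (a.1, (a.2 \o linfun vsval)%VF).

(******************************************************************************)
(*             The map t_D and the actions of A_D and of A_{D,w}              *)
(******************************************************************************)

(* A quotient of the vector space X by W.                                     *)
Record quotSpace (F : fieldType) (X : vectType F) (W : {vspace X}) := QuotSpace {
  quot_space :> vectType F;
  quot_pr : 'Hom(X, quot_space);
  quot_surj : limg quot_pr = fullv;
  quot_ker : lker quot_pr = W
}.

Section Main.
Context (R : realType) (p : nat) (K : padicField p) (E : coefField R K).
Context (Rob : robba E) (n : nat) (alpha : 'I_n -> E) (h : 'I_n -> int).
Context (D : pgdata Rob) (A : autData alpha h).
Context (XG : pgExtSpace D) (kd : kappaData alpha h XG).
Context (barG : quotSpace (extG0 kd)).
Context (XA : repExtSpace (palg A) (pirep A)) (zd : zetaData XA).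

(* The image of Ext^1_w(D, D) in Ext^1(D, D) / Ext^1_0(D, D).                 *)
Definition barG_w (w : 'S_n) : {vspace barG} := (quot_pr barG @: extG kd w)%VS.

(* t o zeta_w is the inverse of kappa_w, for all w.                           *)
Definition inverts_kappa (t : 'Hom(XA, barG)) : Prop :=
  forall w (x : subvs_of (extG kd w)),
    t (zeta zd w (kappa kd w x)) = quot_pr barG (vsval x).

Definition is_tD (t : 'Hom(XA, barG)) : Prop :=
  inverts_kappa t /\ forall t', inverts_kappa t' -> t' = t.

(* A_D = E + (Ext^1(D, D) / Ext^1_0(D, D))^dual and its quotient A_{D,w}.     *)
Definition AD := sqz barG.
HB.instance Definition _ := GRing.ComAlgebra.on AD.
Definition ADw (w : 'S_n) := sqz (subvs_of (barG_w w)).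

(* Actions of A_D by endomorphisms of a representation.                       *)
Definition AD_action (V : rep E n) (act : AD -> V -> V) : Prop :=
  [/\ forall a, rep_mor (act a), forall v, act 1 v = v,
      forall a b v, act (a * b) v = act a (act b v)
    & forall (k : E) a b v, act (k *: a + b) v = k *: act a v + act b v].

(* v' is the image of v under the natural action of a in A_{D,w} on the       *)
(* tautological extension V of pi_alg (x) Ext^1_w by pi: here l is the linear *)
(* form on Ext^1_w(pi_alg, pi) corresponding to the component of a in the     *)
(* maximal ideal via zeta_w o kappa_w (extended to Ext^1(pi_alg, pi), which   *)
(* does not affect te_form l v).                                              *)
Definition natural_action (w : 'S_n) (V : tautExt (extA zd w)) (a : ADw w)
    (v v' : V) : Prop :=
  exists2 l : 'Hom(XA, E^o),
    forall x : subvs_of (extG kd w),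
      l (zeta zd w (kappa kd w x)) =
      a.2 (vsproj (barG_w w) (quot_pr barG (vsval x)))
    & v' = (a.1 : E) *: v + te_i V (jalg A (te_form l v)).

(* The action of A_D on a representation containing V, by inc, preserves V    *)
(* and acts on it through the natural action of A_{D,w}.                      *)
Definition factors_naturally (Vuniv : rep E n) (act : AD -> Vuniv -> Vuniv)
    (w : 'S_n) (V : tautExt (extA zd w)) (inc : V -> Vuniv) : Prop :=
  forall (a : AD) (v : V), exists2 v',
    natural_action (sqz_res (barG_w w) a) v v' & act a (inc v) = inc v'.

End Main.

(* W is isomorphic to the subspace of V cut out by P, with the subspace       *)
(* topology and the action of GL_n(Q_p).                                      *)
Definition iso_subrep (R : realType) (p : nat) (K : padicField p)
    (E : coefField R K) (n : nat) (W V : rep E n) (P : V -> Prop) : Prop :=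
  exists2 f : W -> V, strict_embedding f & forall v, P v <-> exists x, v = f x.

(* Main.v *)
(* A linear form l on Ext^1(D, D) / Ext^1_0(D, D) pulls back along t_D, and   *)
(* (c, l) in A_D acts on pi^univ as c plus the composite of                   *)
(* pi^univ -> pi_alg (x) Ext^1 -> pi_alg -> pi^univ given by l o t_D.         *)
(* Uniqueness holds because the pi^univ_w span pi^univ, which is read off the *)
(* uniqueness of t_D.  The vectors killed by the maximal ideal are those      *)
(* whose image in pi_alg (x) Ext^1 lies in pi_alg (x) Ker t_D; they are the   *)
(* image of pi_1(D), whose map to pi^univ is built from Baer sums.            *)
(* Topologies cause no trouble since pi_alg carries its finest one: every     *)
(* extension of it splits topologically, so that a seminorm on pi^univ is     *)
(* continuous as soon as its restriction to pi is.                            *)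
From HB Require Import structures.
Require Import Defs.
From mathcomp Require Import all_boot all_order all_algebra all_fingroup.
From mathcomp Require Import all_field.
From mathcomp Require Import boolp classical_sets reals.

Set Implicit Arguments.
Unset Strict Implicit.
Unset Printing Implicit Defensive.

Import Order.TTheory GRing.Theory Num.Theory.
Local Open Scope ring_scope.

(** Write X for Ext^1(pi_alg, pi). Modulo pi, a vector of pi^univ is a tensor in pi_alg (x) X, and
    the contractions [te_form l] by linear forms l on X separate these tensors ([te_form_ker]). The
    pair (c, f) acts as c plus contraction by f o t_D followed by pi_alg -> pi -> pi^univ. This is
    multiplicative because contractions vanish on pi, and it is the natural action on pi^univ_w
    because t_D o zeta_w inverts kappa_w ([taut_act_factors]).

    An action is prescribed on each pi^univ_w, so uniqueness asks that the Ext^1_w span X. If the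
    target of t_D is nonzero, this follows from the uniqueness of t_D ([extA_span]); if it is zero,
    A_D is E and acts by scalars ([action_unique]).

    A vector is killed by the maximal ideal when every form factoring through t_D contracts it to 0,
    that is, when its tensor lies in pi_alg (x) Ker t_D ([taut_act_annihilated]). To embed pi_1(D),
    each extension with class in W is mapped to the tautological one ([ext_map_exists]), and these
    maps are glued along pi ([te_incl_exists]). Continuity is always tested on pi alone
    ([seminorm_taut_continuous]). *)

Section LinearPredicate.
Context (F : fieldType) (V W : lmodType F) (f : V -> W) (lf : linear f).

Lemma linD : {morph f : u v / u + v}.
Proof. by move=> u v; have := lf 1 u v; rewrite !scale1r. Qed.

Lemma lin0 : f 0 = 0.
Proof. by apply: (addrI (f 0)); rewrite -linD !addr0. Qed.

Lemma linZ a : {morph f : u / a *: u}.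
Proof. by move=> u; have := lf a u 0; rewrite lin0 !addr0. Qed.

Lemma linN : {morph f : u / - u}.
Proof. by move=> u; rewrite -scaleN1r linZ scaleN1r. Qed.

Lemma linB : {morph f : u v / u - v}.
Proof. by move=> u v; rewrite linD linN. Qed.

Lemma lin_sum (I : finType) (u : I -> V) : f (\sum_i u i) = \sum_i f (u i).
Proof. exact: (big_morph f linD lin0). Qed.

End LinearPredicate.

(** * Complements, sections and retractions in arbitrary dimension *)

Section Complement.
Context (F : fieldType) (V : lmodType F) (U : V -> Prop).
Context (subU : subspace_prop U).

Lemma subspaceD u v : U u -> U v -> U (u + v).
Proof. by move=> uU vU; rewrite -[u]scale1r; exact: subU.2. Qed.

Lemma subspaceZ a u : U u -> U (a *: u).
Proof.
by move=> uU; rewrite -[_ *: _]addr0; apply: subU.2 => //; exact: subU.1.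
Qed.

Lemma subspaceN u : U u -> U (- u).
Proof. by rewrite -scaleN1r; exact: subspaceZ. Qed.

Lemma subspaceB u v : U u -> U v -> U (u - v).
Proof. by move=> uU /subspaceN; exact: subspaceD. Qed.

(** Zorn's lemma, applied to the sets stable under a *: u + v that meet U at most in 0: a vector
    outside U + C could be adjoined to a maximal C. *)
Lemma exists_complement : exists C : V -> Prop,
  [/\ subspace_prop C, forall v, U v -> C v -> v = 0
    & forall v, exists2 u, U u & C (v - u)].
Proof.
pose P (C : set V) := (forall a u v, C u -> C v -> C (a *: u + v)) /\
  (forall v, U v -> C v -> v = 0).
have [G GP Gtot|C [[CD CU] Cmax]] := @Zorn_bigcup V P.
  split=> [a u v [X GX Xu] [Y GY Yv]|v Uv [X /GP[_ XU]]]; last exact: XU.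
  have [XY|YX] := Gtot _ _ GX GY.
    by exists Y => //; apply: (GP _ GY).1 => //; exact: XY.
  by exists X => //; apply: (GP _ GX).1 => //; exact: YX.
(* The union of the empty chain is empty, so [P] cannot demand 0; maximality supplies it. *)
have C0 : C 0.
  apply: contrapT => nC0; apply: (Cmax (fun v => C v \/ v = 0)).
    by split=> [v|CC]; [left|apply: nC0; apply: CC; right].
  split=> [a u v [Cu|->] [Cv|->]|v Uv []//]; last exact: CU.
  - by left; exact: CD.
  - left; have := CD (a - 1) _ _ Cu Cu.
    by rewrite scalerBl scale1r subrK addr0.
  - by left; rewrite scaler0 add0r.
  - by right; rewrite scaler0 addr0.
have CZ a v : C v -> C (a *: v).
  by move=> Cv; rewrite -[_ *: _]addr0; exact: CD.
exists C; split=> // v; apply: contrapT => nv.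
pose C' (x : V) := exists a c, C c /\ x = a *: v + c.
apply: (Cmax C').
  split=> [x Cx|CC]; first by exists 0, x; rewrite scale0r add0r.
  apply: nv; exists 0; first exact: subU.1.
  by apply: CC; exists 1, 0; rewrite scale1r addr0 subr0.
split=> [a _ _ [b [c [Cc ->]]] [b' [c' [Cc' ->]]]|x + [a [c [Cc xE]]]].
  exists (a * b + b'), (a *: c + c'); split; first exact: CD.
  by rewrite scalerDr scalerA addrACA -scalerDl.
rewrite {}xE; have [-> | a0] := eqVneq a 0.
  by rewrite scale0r add0r => Uc; exact: CU.
move=> Ux; case: nv; exists (a^-1 *: (a *: v + c)); first exact: subspaceZ.
rewrite scalerDr scalerA mulVf // scale1r opprD addrA subrr sub0r.
by rewrite -scalerN -scaleN1r; do 2!apply: (CZ _ _).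
Qed.

End Complement.

Section SectionRetraction.
Context (F : fieldType) (V W : lmodType F) (f : V -> W) (lf : linear f).

(** The preimage lying in a complement of the kernel is unique, hence depends linearly on w. *)
Lemma surjective_section : (forall w, exists v, f v = w) ->
  exists2 s : W -> V, linear s & cancel s f.
Proof.
move=> fsurj.
have kerf : subspace_prop (fun v => f v = 0).
  split=> [|a u v fu fv]; first exact: lin0 lf.
  by rewrite lf fu fv scaler0 addr0.
have [C [subC CK CV]] := exists_complement kerf.
have /choice[s sP] w : exists v, C v /\ f v = w.
  have [v fv] := fsurj w; have [u fu Cvu] := CV v.
  by exists (v - u); rewrite (linB lf) fv fu subr0.
exists s => [a u v|w]; last exact: (sP w).2.
apply/eqP; rewrite -subr_eq0; apply/eqP; apply: CK.
  by rewrite (linB lf) (sP _).2 lf !(sP _).2 subrr.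
apply: (subspaceB subC (sP _).1); apply: subC.2; exact: (sP _).1.
Qed.

Lemma injective_retraction : injective f ->
  exists2 r : W -> V, linear r & cancel f r.
Proof.
move=> finj.
have imf : subspace_prop (fun w => exists v, f v = w).
  split=> [|a _ _ [u <-] [v <-]]; first by exists 0; exact: lin0 lf.
  by exists (a *: u + v); exact: lf.
have [C [subC CK CV]] := exists_complement imf.
have /choice[r rP] w : exists v, C (w - f v).
  by have [_ [v <-]] := CV w; exists v.
have runiq v w : C (w - f v) -> r w = v.
  move=> Cv; apply: finj; apply/eqP; rewrite -subr_eq0; apply/eqP; apply: CK.
    by exists (r w - v); exact: linB lf _ _.
  have := subspaceB subC Cv (rP w).
  by rewrite opprB [X in C X]addrC addrA subrK.
exists r => [a u v|v]; last by apply: runiq; rewrite subrr; exact: subC.1.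
apply: runiq; have := subC.2 a _ _ (rP u) (rP v).
by rewrite lf opprD addrACA -scalerBr.
Qed.

(* Seminorms and the topology of extensions *)
End SectionRetraction.

Section Topology.
Context (R : realType) (p : nat) (K : padicField p) (E : coefField R K).

Lemma seminormN (V : lmodType E) (q : V -> R) v : seminorm q -> q (- v) = q v.
Proof.
case=> _ qZ _; rewrite -scaleN1r qZ.
suff -> : nrm (-1 : E) = 1 by rewrite mul1r.
have : nrm (-1 : E) ^+ 2 = 1 ^+ 2.
  rewrite expr2 -nrmM mulrNN mulr1 expr1n; apply: (@mulfI _ (nrm (1 : E))).
    by rewrite nrm_eq0 oner_eq0.
  by rewrite -nrmM !mulr1.
by move=> /eqP; rewrite eqrXn2 ?nrm_ge0 // => /eqP.
Qed.

Lemma seminorm_comp (V W : lmodType E) (f : V -> W) (q : W -> R) :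
  linear f -> seminorm q -> seminorm (fun v => q (f v)).
Proof.
move=> lf [q0 qZ qD]; split=> [v|a v|u v]; first exact: q0.
  by rewrite (linZ lf) qZ.
by rewrite (linD lf).
Qed.

Lemma seminorm_max (V : lmodType E) (q q' : V -> R) :
  seminorm q -> seminorm q' -> seminorm (fun v => Num.max (q v) (q' v)).
Proof.
move=> [q0 qZ qD] [q0' qZ' qD']; split=> [v|a v|u v].
- by rewrite le_max q0.
- by rewrite qZ qZ' maxr_pMr // nrm_ge0.
rewrite ge_max; apply/andP; split.
  by apply: le_trans (qD _ _) _; rewrite ge_max !le_max !lexx ?orbT.
by apply: le_trans (qD' _ _) _; rewrite ge_max !le_max !lexx ?orbT.
Qed.

Lemma lctop_le (V : lmodType E) (cs : (V -> R) -> Prop) (q q' : V -> R) :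
  is_lctop cs -> cs q -> seminorm q' -> (forall v, q' v <= q v) -> cs q'.
Proof.
move=> [_ _ _ csle] csq sq' le_q'q; apply: (csle q q' 1) => // v.
by rewrite mul1r.
Qed.

Context (n : nat) (A B : rep E n).
Context (B_finest : forall q, rep_cs B q <-> seminorm q).

(* A linear section of [re_q] is continuous, as B has its finest topology;    *)
(* hence an extension of B by A is the topological direct sum of A and B.     *)
Lemma seminorm_ext_continuous (e : repExt B A) (q : e -> R) :
  seminorm q -> rep_cs _ (fun x => q (re_i e x)) -> rep_cs _ q.
Proof.
move=> sq csq; have [[eT _] _ _ _] := re_adm e; have [elc _ _ _ _] := eT.
have [[qlin _ qcont] qsurj _] := re_qP e.
have [_ _ istrict] := re_iP e; have [s css qs] := istrict _ csq.
have ss : seminorm s by case: elc => + _ _ _; apply.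
have [sec lsec secK] := surjective_section qlin qsurj.
(* Write v = (v - sec (re_q v)) + sec (re_q v). On the first summand, which comes from A, q is
   bounded by s; [N] controls what the section contributes. *)
pose N := fun b : B => Num.max (q (sec b)) (s (sec b)).
have csN : rep_cs _ (fun v => N (re_q e v)).
  apply/qcont/B_finest.
  by apply: seminorm_max; exact: seminorm_comp.
have csm : rep_cs _ (fun v => Num.max (s v) (N (re_q e v))).
  by case: elc => _ _ + _; apply.
apply: (lctop_le elc csm sq) => v.
have /re_exact[x vE] : re_q e (v - sec (re_q e v)) = 0.
  by rewrite (linB qlin) secK subrr.
have [_ _ qD] := sq; have [_ _ sD] := ss.
rewrite -{1}(subrK (sec (re_q e v)) v); apply: le_trans (qD _ _) _.
rewrite ge_max; apply/andP; split; last by rewrite /N !le_max lexx orbT.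
rewrite vE; apply: le_trans (qs _) _; rewrite -vE.
apply: le_trans (sD _ _) _; rewrite seminormN //.
by rewrite ge_max /N !le_max !lexx ?orbT.
Qed.

End Topology.

(** * Tautological extensions: contractions and maps from single extensions *)

Section Tautological.
Context (R : realType) (p : nat) (K : padicField p) (E : coefField R K).
Context (n : nat) (A B : rep E n) (X : repExtSpace B A).
Context (A_top : top_rep A).
Context (B_top : top_rep B).
Context (B_finest : forall q, rep_cs B q <-> seminorm q).

Lemma re_i_lin (e : repExt B A) : linear (re_i e).
Proof. by case: (re_iP e) => -[]. Qed.

Lemma re_q_lin (e : repExt B A) : linear (re_q e).
Proof. by case: (re_qP e) => -[]. Qed.

Lemma re_i_inj (e : repExt B A) : injective (re_i e).
Proof. by case: (re_iP e). Qed.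

Lemma re_q_i (e : repExt B A) x : re_q e (re_i e x) = 0.
Proof. by apply/re_exact; exists x. Qed.

Lemma re_q_surj (e : repExt B A) b : exists v, re_q e v = b.
Proof. by case: (re_qP e). Qed.

Lemma re_act_lin (e : repExt B A) g : g \in unitmx ->
  linear (rep_act g : e -> e).
Proof. by case: (re_adm e) => -[[_ + _ _ _] _] _ _ _; apply. Qed.

Lemma re_q_act (e : repExt B A) g v : g \in unitmx ->
  re_q e (rep_act g v) = rep_act g (re_q e v).
Proof. by case: (re_qP e) => -[_ + _] _ _; apply. Qed.

Lemma re_i_act (e : repExt B A) g v : g \in unitmx ->
  re_i e (rep_act g v) = rep_act g (re_i e v).
Proof. by case: (re_iP e) => -[_ + _] _ _; apply. Qed.

Arguments re_i_lin e : clear implicits.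
Arguments re_q_lin e : clear implicits.
Arguments re_act_lin e : clear implicits.
Arguments re_q_surj e : clear implicits.

Section OneExtension.
Context (W : {vspace X}) (T : tautExt W).
Local Notation iT := (te_i T).
Local Notation uT k := (te_u (t := T) (k := k)).
Local Notation qT := (te_q (t := T)).

Lemma te_i_lin : linear iT.
Proof. by case: (te_imor T). Qed.

Lemma te_u_lin k : linear (uT k).
Proof. by case: (te_umor T k). Qed.

Lemma seminorm_taut_continuous (q : T -> R) :
  seminorm q -> rep_cs A (fun x => q (iT x)) -> rep_cs T q.
Proof.
move=> sq csq; apply: te_final => // k.
apply: (seminorm_ext_continuous B_finest).
  exact: seminorm_comp (@te_u_lin k) sq.
by have -> : (fun x => q (uT k (re_i (te_e T k) x))) = (fun x => q (iT x));
  first by apply/funext => x; rewrite te_glue.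
Qed.

Lemma te_form_lin l : linear (te_form (T := T) l).
Proof.
move=> a u v; rewrite /te_form scaler_sumr -big_split /=; apply: eq_bigr => k _.
by rewrite te_qlin scalerDr !scalerA mulrC.
Qed.

Lemma te_formP a l l' (v : T) :
  te_form (a *: l + l') v = a *: te_form l v + te_form l' v.
Proof.
rewrite /te_form scaler_sumr -big_split /=; apply: eq_bigr => k _.
by rewrite lfunE /= lfunE /= scalerDl scalerA.
Qed.

Lemma te_form0 (v : T) : te_form 0 v = 0.
Proof. by rewrite /te_form big1 // => k _; rewrite lfunE scale0r. Qed.

Lemma te_form_eq (l l' : 'Hom(X, E^o)) (v : T) :
  {in W, l =1 l'} -> te_form l v = te_form l' v.
Proof.
move=> ll'; apply: eq_bigr => k _; congr ((_ : E) *: _); apply: ll'.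
exact: basis_mem (te_basis T) (mem_tnth _ _).
Qed.

Lemma te_form_i l x : te_form l (iT x) = 0.
Proof. by rewrite /te_form big1 // => k _; rewrite te_qi scaler0. Qed.

Lemma te_form_u l k y :
  te_form l (uT k y) = (l (tnth (te_b T) k) : E) *: re_q (te_e T k) y.
Proof.
rewrite /te_form (bigD1 k) //= big1 => [|j jk]; rewrite te_qu ?eqxx ?addr0 //.
by rewrite (negPf jk) scaler0.
Qed.

(** Contracting with the dual basis recovers the coordinates, so an identity known for all forms l
    holds coordinatewise. *)
Lemma te_q_form k (v : T) :
  qT k v = te_form (linfun (coord (te_b T) k : X -> E^o)) v.
Proof.
have bfree : free (te_b T) := basis_free (te_basis T).
rewrite /te_form (bigD1 k) //= big1 => [|j jk].
  by rewrite addr0 lfunE /= (tnth_nth 0) coord_free // eqxx scale1r.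
by rewrite lfunE /= (tnth_nth 0) coord_free // (negPf (jk : j != k)) scale0r.
Qed.

Lemma te_i_inj : injective iT.
Proof.
move=> x x' /eqP; rewrite -subr_eq0 -(linB te_i_lin) => /eqP ixx'.
have [|z [z0]] := @te_ker _ _ _ _ _ _ _ _ _ T (x - x') (fun=> 0).
  by rewrite big1 ?addr0 // => k _; rewrite (lin0 (@te_u_lin k)).
rewrite big1 => [|k _].
  by rewrite addr0 => /eqP; rewrite subr_eq0 => /eqP.
by apply: (@re_i_inj (te_e T k)); rewrite -z0 (lin0 (re_i_lin _)).
Qed.

(** All coordinates of v vanish, so each component [y k] comes from A, and the gluing gathers these
    components into one element of A. *)
Lemma te_form_ker (v : T) : (forall l, te_form l v = 0) -> exists x, v = iT x.
Proof.
move=> v0; have [x [y vE]] := te_surj v.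
have yz k : exists z, y k = re_i (te_e T k) z.
  apply/re_exact.
  have : qT k v = 0 by rewrite te_q_form v0.
  have qlin := @te_qlin _ _ _ _ _ _ _ _ _ T k.
  rewrite vE (linD qlin) te_qi add0r (lin_sum qlin) (bigD1 k) //=.
  rewrite te_qu eqxx big1 ?addr0 // => j jk.
  by rewrite te_qu ifN // eq_sym.
pose z k := sval (cid (yz k)).
exists (x + \sum_k z k); rewrite vE (linD te_i_lin) (lin_sum te_i_lin).
congr (_ + _); apply: eq_bigr => k _.
by rewrite (svalP (cid (yz k))) te_glue.
Qed.

(** Surjectivity onto B (x) W: the tensor \sum_i b_i (x) x_i is expanded in the basis of W, and its
    k-th coordinate [c k] is lifted to [te_e T k]. *)
Lemma te_lift (I : finType) (x : I -> X) (b : I -> B) :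
  (forall i, x i \in W) ->
  exists v : T, forall l, te_form l v = \sum_i (l (x i) : E) *: b i.
Proof.
move=> xW.
pose c k := \sum_i coord (te_b T) k (x i) *: b i.
pose y k := sval (cid (re_q_surj (te_e T k) (c k))).
exists (\sum_k uT k (y k)) => l; rewrite (lin_sum (te_form_lin l)).
under eq_bigr do rewrite te_form_u (svalP (cid (re_q_surj _ _))) scaler_sumr.
rewrite exchange_big /=; apply: eq_bigr => i _.
rewrite {2}(coord_basis (te_basis T) (xW i)) linear_sum scaler_suml /=.
by apply: eq_bigr => k _; rewrite scalerA (tnth_nth 0) linearZ /= mulrC.
Qed.

(* A morphism of e to T over A, inducing b |-> b (x) [e] on the quotient.     *)
Definition ext_map (e : repExt B A) (f : e -> T) : Prop :=
  [/\ linear f, forall g v, g \in unitmx -> f (rep_act g v) = rep_act g (f v),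
      forall x, f (re_i e x) = iT x
    & forall (l : 'Hom(X, E^o)) v,
        te_form l (f v) = (l (rx_cl X e) : E) *: re_q e v].

Lemma te_i_act g x : g \in unitmx -> iT (rep_act g x) = rep_act g (iT x).
Proof. by case: (te_imor T) => _ + _; apply. Qed.

Lemma te_act_lin g : g \in unitmx -> linear (rep_act g : T -> T).
Proof. by case: (te_top T) => _ + _ _ _; apply. Qed.

Lemma ext_map_basis k (e : repExt B A) (a : E) :
  rx_cl X e = a *: tnth (te_b T) k -> a != 0 -> exists f, ext_map (e := e) f.
Proof.
move=> eE a0; have /rx_scale[g [[glin gact _] gi gq]] :
    rx_cl X (te_e T k) = a^-1 *: rx_cl X e.
  by rewrite eE scalerA mulVf // scale1r te_class.
have [_ uact _] := te_umor T k.
(* On A the map [g] is multiplication by a^-1 and on B it is the identity; the factor a makes it the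
   identity on A and a on B, as [e] = a b_k requires. *)
exists (fun v => a *: uT k (g v)); split=> [b u v|h v hU|x|l v].
- by rewrite glin te_u_lin scalerDr !scalerA mulrC.
- by rewrite gact // uact // (linZ (te_act_lin hU)).
- by rewrite gi te_glue (linZ te_i_lin) scalerA mulfV // scale1r.
by rewrite (linZ (te_form_lin l)) te_form_u gq scalerA eE linearZ.
Qed.

(** As 0 is 0 times [e], there is an endomorphism [g] of e killing A and inducing the identity on B;
    v - g v is then a retraction onto A. *)
Lemma ext_map_split (e : repExt B A) :
  rx_cl X e = 0 -> exists f, ext_map (e := e) f.
Proof.
move=> e0; have /rx_scale[g [[glin gact _] gi gq]] :
  rx_cl X e = 0 *: rx_cl X e by rewrite scale0r.
have /choice[r rP] v : exists x, re_i e x = v - g v.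
  have /re_exact[x ->] : re_q e (v - g v) = 0.
    by rewrite (linB (re_q_lin e)) gq subrr.
  by exists x.
exists (fun v => iT (r v)); split=> [a u v|h v hU|x|l v].
- rewrite -te_i_lin; congr iT; apply: (@re_i_inj e).
  by rewrite re_i_lin !rP glin scalerBr opprD addrACA.
- rewrite -te_i_act //; congr iT; apply: (@re_i_inj e).
  by rewrite re_i_act // !rP gact // (linB (re_act_lin _ _ hU)).
- congr iT; apply: (@re_i_inj e).
  by rewrite rP gi scale0r (lin0 (re_i_lin e)) subr0.
by rewrite te_form_i e0 linear0 scale0r.
Qed.

(** The map f + f' on the fibre product descends along [h] to the Baer sum: pairs killed by [h] come
    from some (x, x') in A + A with x + x' = 0, where f + f' vanishes. *)
Lemma ext_mapD (e e' e'' : repExt B A) f f' :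
  rx_cl X e'' = rx_cl X e + rx_cl X e' ->
  ext_map (e := e) f -> ext_map (e := e') f' ->
  exists f'', ext_map (e := e'') f''.
Proof.
move=> cE [flin fact fi fq] [flin' fact' fi' fq'].
have /rx_add[h [hlin hact _ hi hq]] := cE.
pose fib v v' := re_q e v = re_q e' v'.
have fibP a u u' v v' : fib u u' -> fib v v' ->
    fib (a *: u + v) (a *: u' + v').
  by rewrite /fib !re_q_lin => -> ->.
have h_surj v'' : exists w : e * e', fib w.1 w.2 /\ h w.1 w.2 = v''.
  have [v vE] := re_q_surj e (re_q e'' v'').
  have [v' vE'] := re_q_surj e' (re_q e'' v'').
  have vv' : fib v v' by rewrite /fib vE vE'.
  have /re_exact[z zE] : re_q e'' (v'' - h v v') = 0.
    by rewrite (linB (re_q_lin _)) hq // vE subrr.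
  have zz : fib (re_i e z) (re_i e' 0) by rewrite /fib !re_q_i.
  (* The coefficients 1 put the pair in the form that the linearity of [h] accepts. *)
  exists (1 *: re_i e z + v, 1 *: re_i e' 0 + v') => /=.
  split; first exact: fibP.
  by rewrite hlin // hi addr0 -zE scale1r subrK.
have /choice[w wP] := h_surj.
have f_unique v v' u u' : fib v v' -> fib u u' -> h v v' = h u u' ->
    f v + f' v' = f u + f' u'.
  move=> vv' uu' hE; pose d := (-1) *: u + v; pose d' := (-1) *: u' + v'.
  have dd' : fib d d' by exact: fibP.
  have hd : h d d' = 0 by rewrite hlin // hE scaleN1r addNr.
  have /re_exact[x xE] : re_q e d = 0.
    by rewrite -(hq _ _ dd') hd (lin0 (re_q_lin _)).
  have /re_exact[x' xE'] : re_q e' d' = 0 by rewrite -dd' xE re_q_i.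
  have xx' : x + x' = 0.
    by apply: (@re_i_inj e''); rewrite -hi -xE -xE' hd (lin0 (re_i_lin _)).
  have : f d + f' d' = 0.
    by rewrite xE xE' fi fi' -(linD te_i_lin) xx' (lin0 te_i_lin).
  rewrite /d /d' flin flin' addrACA -scalerDr scaleN1r addrC => /eqP.
  by rewrite subr_eq0 => /eqP.
pose f'' v := f (w v).1 + f' (w v).2.
have f''E v v' : fib v v' -> f'' (h v v') = f v + f' v'.
  by move=> vv'; apply: f_unique => //; case: (wP (h v v')).
exists f''; split=> [a u v|g v gU|x|l v].
- have [[uu' {1}<-] [vv' {1}<-]] := (wP u, wP v).
  rewrite -hlin // f''E; last exact: fibP.
  by rewrite flin flin' addrACA -scalerDr.
- have [vv' {1}<-] := wP v.
  rewrite -hact // f''E; last by rewrite /fib !re_q_act // vv'.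
  by rewrite fact // fact' // (linD (te_act_lin gU)).
- rewrite -[x in LHS]addr0 -hi f''E; last by rewrite /fib !re_q_i.
  by rewrite fi fi' (lin0 te_i_lin) addr0.
have [vv' {2}<-] := wP v; rewrite hq // (linD (te_form_lin l)) fq fq' -vv'.
by rewrite -scalerDl cE linearD.
Qed.

(** [P] speaks of all extensions with a given class, so that it passes through the expansion of the
    class in the basis of W. *)
Lemma ext_map_exists (e : repExt B A) :
  rx_cl X e \in W -> exists f, ext_map (e := e) f.
Proof.
move=> eW; pose P x := forall e, rx_cl X e = x -> exists f, ext_map (e := e) f.
suff : P (rx_cl X e) by apply.
have PD x y : P x -> P y -> P (x + y).
  move=> Px Py e'' cE.
  have [[e1 e1E] [e2 e2E]] := (rx_surj x, rx_surj y).
  have [[f fP] [f' fP']] := (Px _ e1E, Py _ e2E).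
  by apply: ext_mapD fP fP'; rewrite cE e1E e2E.
have P0 : P 0 by move=> ? /ext_map_split.
rewrite (coord_basis (te_basis T) eW); apply: big_ind => // k _ e'.
rewrite -tnth_nth; have [->|a0] := eqVneq (coord (te_b T) k (rx_cl X e)) 0.
  by rewrite scale0r => /P0.
by move=> /ext_map_basis; apply.
Qed.

Lemma te_form_mor l : rep_mor (te_form (T := T) l).
Proof.
split=> [|g v gU|q /B_finest sq]; first exact: te_form_lin.
  have [_ /(_ g gU) Bact _ _ _] := B_top.
  have [x [y ->]] := te_surj v.
  rewrite (linD (te_act_lin gU)) (lin_sum (te_act_lin gU)) -te_i_act //.
  rewrite !(linD (te_form_lin l)) !te_form_i !add0r !(lin_sum (te_form_lin l)).
  rewrite (lin_sum Bact); apply: eq_bigr => k _.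
  have [_ uact _] := te_umor T k.
  by rewrite -uact // !te_form_u re_q_act // (linZ Bact).
apply: seminorm_taut_continuous; first exact: seminorm_comp (te_form_lin l) sq.
have -> : (fun x => q (te_form l (iT x))) = fun=> 0.
  by apply/funext => x; rewrite te_form_i (seminorm0 sq).
by case: A_top => -[].
Qed.

End OneExtension.

(** * Embedding and spanning by smaller tautological extensions *)

Lemma te_incl_exists (W' W : {vspace X}) (T' : tautExt W') (T : tautExt W) :
  (W' <= W)%VS -> exists F : T' -> T, te_incl F.
Proof.
move=> sW'W.
have fex k : exists f, ext_map (T := T) (e := te_e T' k) f.
  apply: ext_map_exists; rewrite te_class; apply: (subvP sW'W).
  exact: basis_mem (te_basis T') (mem_tnth _ _).
pose f k := sval (cid (fex k)).
have flin k : linear (f k) by rewrite /f; case: cid => ? [].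
have fact k g v : g \in unitmx -> f k (rep_act g v) = rep_act g (f k v).
  by rewrite /f; case: cid => ? [? + ? ?]; apply.
have fi k x : f k (re_i (te_e T' k) x) = te_i T x.
  by rewrite /f; case: cid => ? [? ? + ?]; apply.
have fq k (l : 'Hom(X, E^o)) v : te_form l (f k v) =
    (l (tnth (te_b T') k) : E) *: re_q (te_e T' k) v.
  by rewrite -te_class /f; case: cid => ? [? ? ? +]; apply.
(* Presentations of v by components are not unique, so the glued map is first a linear relation;
   [te_ker] shows that it is single-valued. *)
pose graph v w := exists x (y : forall k, te_e T' k),
  v = te_i T' x + \sum_k te_u (y k) /\ w = te_i T x + \sum_k f k (y k).
have graph_lin a u u' v v' :
    graph u u' -> graph v v' -> graph (a *: u + v) (a *: u' + v').
  move=> [x [y [-> ->]]] [x' [y' [-> ->]]].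
  exists (a *: x + x'), (fun k => a *: y k + y' k).
  rewrite !scalerDr !scaler_sumr (addrACA (a *: te_i T' x)).
  rewrite (addrACA (a *: te_i T x)) -!te_i_lin -!big_split /=.
  by split; congr (_ + _); apply: eq_bigr => k _; rewrite ?te_u_lin ?flin.
have graph0 w : graph 0 w -> w = 0.
  move=> [x [y [/esym/te_ker[z [yE xz]] ->]]].
  have -> : \sum_k f k (y k) = te_i T (\sum_k z k).
    by rewrite (lin_sum (@te_i_lin _ T)); apply: eq_bigr => k _; rewrite yE fi.
  by rewrite -(linD (@te_i_lin _ T)) xz (lin0 (@te_i_lin _ T)).
have /choice[F FP] v : exists w, graph v w.
  by have [x [y vE]] := te_surj v; do 3!eexists; split; [exact: vE|].
have F_unique v w : graph v w -> F v = w.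
  move=> vw; have := graph_lin (-1) _ _ _ _ vw (FP v).
  by rewrite !scaleN1r addNr addrC => /graph0/eqP; rewrite subr_eq0 => /eqP.
have Flin : linear F by move=> a u v; apply: F_unique; exact: graph_lin.
have Fi x : F (te_i T' x) = te_i T x.
  apply: F_unique; exists x, (fun k => 0).
  rewrite !big1 ?addr0 // => k _; [exact: lin0 (flin k)|].
  exact: lin0 (@te_u_lin _ T' k).
have Fform (l : 'Hom(X, E^o)) v : te_form l (F v) = te_form l v.
  have [x [y [vE ->]]] := FP v; rewrite vE.
  rewrite !(linD (@te_form_lin _ _ l)) !te_form_i.
  rewrite !(lin_sum (@te_form_lin _ _ l)).
  by congr (_ + _); apply: eq_bigr => k _; rewrite fq te_form_u.
have Fact g v : g \in unitmx -> F (rep_act g v) = rep_act g (F v).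
  move=> gU; apply: F_unique; have [x [y [vE ->]]] := FP v; rewrite vE.
  exists (rep_act g x), (fun k => rep_act g (y k)).
  rewrite !(linD (te_act_lin gU)) !(lin_sum (te_act_lin gU)) -!te_i_act //.
  split; congr (_ + _); apply: eq_bigr => k _; rewrite ?fact //.
  by have [_ uact _] := te_umor T' k; rewrite uact.
have Finj : injective F.
  move=> u v /eqP; rewrite -subr_eq0 -(linB Flin) => /eqP Fuv.
  have [|x xE] := @te_form_ker _ T' (u - v).
    by move=> l; rewrite -Fform Fuv (lin0 (@te_form_lin _ _ l)).
  have x0 : x = 0.
    by apply: (@te_i_inj _ T); rewrite -Fi -xE Fuv (lin0 (@te_i_lin _ T)).
  move/eqP: xE; rewrite x0 (lin0 (@te_i_lin _ T')).
  by rewrite subr_eq0 => /eqP.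
have [Tlc _ _ _ _] := te_top T; have [T'lc _ _ _ _] := te_top T'.
exists F; split=> //; split=> // [|r csr]; first split=> // r csr.
  have sr : seminorm r by case: Tlc => + _ _ _; apply.
  apply: seminorm_taut_continuous; first exact: seminorm_comp Flin sr.
  have -> : (fun x => r (F (te_i T' x))) = (fun x => r (te_i T x)).
    by apply/funext => x; rewrite Fi.
  by case: (te_imor T) => _ _; apply.
have sr : seminorm r by case: T'lc => + _ _ _; apply.
(* For strictness, r o rho extends r along [F]. It agrees with r on A, hence is continuous although
   [rho] is only linear. *)
have [rho rholin rhoK] := injective_retraction Flin Finj.
exists (fun v => r (rho v)); last by move=> v; rewrite rhoK.
apply: seminorm_taut_continuous; first exact: seminorm_comp rholin sr.
have -> : (fun x => r (rho (te_i T x))) = (fun x => r (te_i T' x)).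
  by apply/funext => x; rewrite -Fi rhoK.
by case: (te_imor T') => _ _; apply.
Qed.

(* Decompose the tensor \sum_k te_q k v (x) b_k along the subspaces W_ i.     *)
Lemma te_span (I : finType) (W : {vspace X}) (W_ : I -> {vspace X})
    (T : tautExt W) (T_ : forall i, tautExt (W_ i))
    (inc : forall i, T_ i -> T) (incP : forall i, te_incl (@inc i)) (v : T) :
  (W <= \sum_i W_ i)%VS ->
  exists x (u : forall i, T_ i), v = te_i T x + \sum_i inc i (u i).
Proof.
move=> sWW_.
have cex k : exists2 c : I -> X, forall i, c i \in W_ i &
    tnth (te_b T) k = \sum_i c i.
  have /memv_sumP[c cW cE] : tnth (te_b T) k \in (\sum_i W_ i)%VS.
    by apply: (subvP sWW_); exact: basis_mem (te_basis T) (mem_tnth _ _).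
  by exists c => // i; exact: cW.
pose c k := s2val (cid2 (cex k)).
have uex i : exists u : T_ i, forall l : 'Hom(X, E^o),
    te_form l u = \sum_k (l (c k i) : E) *: te_q k v.
  by apply: te_lift => k; exact: (s2valP (cid2 (cex k))).
pose u i := sval (cid (uex i)).
have [|x xE] := @te_form_ker _ T (v - \sum_i inc i (u i)); last first.
  by exists x, u; rewrite -xE subrK.
move=> l; rewrite (linB (@te_form_lin _ _ l)) (lin_sum (@te_form_lin _ _ l)).
apply/eqP; rewrite subr_eq0; apply/eqP.
transitivity (\sum_i \sum_k (l (c k i) : E) *: te_q k v); last first.
  apply: eq_bigr => i _; have [_ _ ->] := incP i.
  by rewrite (svalP (cid (uex i))).
rewrite exchange_big /=; apply: eq_bigr => k _.
by rewrite (s2valP' (cid2 (cex k))) linear_sum scaler_suml.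
Qed.

(** * The action of a square-zero algebra and the vectors killed by its maximal ideal *)

Section SquareZeroAction.
Context (W : {vspace X}) (T : tautExt W) (j : B -> A) (j_mor : rep_mor j).
Context (U : vectType E) (t : 'Hom(X, U)).

Definition taut_act (a : sqz U) (v : T) : T :=
  (a.1 : E) *: v + te_i T (j (te_form (a.2 \o t)%VF v)).

Lemma te_i_j_lin : linear (fun b => te_i T (j b)).
Proof. by case: j_mor => jlin _ _ a u v; rewrite jlin te_i_lin. Qed.

Lemma taut_act_mor a : rep_mor (taut_act a).
Proof.
have [jlin jact jcont] := j_mor.
have act_lin : linear (taut_act a).
  move=> k u v; rewrite /taut_act te_form_lin te_i_j_lin scalerDr addrACA.
  by rewrite scalerDr !scalerA [k * _]mulrC.
(* On A the action is by the scalar a.1, which is all that the continuity test sees. *)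
have act_i x : taut_act a (te_i T x) = te_i T ((a.1 : E) *: x).
  rewrite /taut_act te_form_i (lin0 te_i_j_lin) addr0.
  by rewrite (linZ (@te_i_lin _ T)).
split=> // [g v gU|q csq].
  have [_ formact _] := te_form_mor T (a.2 \o t)%VF.
  rewrite /taut_act formact // jact // te_i_act // (linD (te_act_lin gU)).
  by rewrite (linZ (te_act_lin gU)).
have [Tlc _ _ _ _] := te_top T; have [lcs _ _ lcle] := Tlc.
have sq := lcs _ csq.
apply: seminorm_taut_continuous; first exact: seminorm_comp act_lin sq.
have -> : (fun x => q (taut_act a (te_i T x))) =
    (fun x => nrm (a.1 : E) * q (te_i T x)).
  apply/funext => x; rewrite act_i (linZ (@te_i_lin _ T)).
  by case: sq => _ -> _.
have [[_ _ _ Alcle] _ _ _ _] := A_top; have [_ _ icont] := te_imor T.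
apply: (Alcle (fun x => q (te_i T x)) _ (nrm (a.1 : E))) => //.
  exact: icont.
have -> : (fun x => nrm (a.1 : E) * q (te_i T x)) =
    (fun x => q (te_i T ((a.1 : E) *: x))).
  apply/funext => x; rewrite (linZ (@te_i_lin _ T)).
  by case: sq => _ -> _.
split=> [x|k x|x y]; case: sq => q0 qZ qD; first exact: q0.
  by rewrite !(linZ (@te_i_lin _ T)) !qZ mulrCA.
by rewrite scalerDr (linD (@te_i_lin _ T)) qD.
Qed.

Lemma taut_act1 v : taut_act 1 v = v.
Proof.
rewrite /taut_act /= scale1r -[RHS]addr0; congr (_ + _).
rewrite -[RHS](lin0 te_i_j_lin); congr (te_i T (j _)).
by rewrite comp_lfun0l te_form0.
Qed.

Lemma taut_actP k a b v :
  taut_act (k *: a + b) v = k *: taut_act a v + taut_act b v.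
Proof.
rewrite /taut_act /= comp_lfunDl -comp_lfunZl te_formP te_i_j_lin.
by rewrite scalerDl scalerDr addrACA scalerA.
Qed.

(** The nilpotent parts compose to 0, since they take values in A, where [te_form] vanishes. *)
Lemma taut_actM a b v : taut_act (a * b) v = taut_act a (taut_act b v).
Proof.
rewrite {1 2}/taut_act te_form_lin te_form_i addr0 (linZ te_i_j_lin).
rewrite /taut_act /= comp_lfunDl -!comp_lfunZl te_formP te_i_j_lin.
rewrite -[b.1 *: (a.2 \o t)%VF]addr0 te_formP te_i_j_lin.
by rewrite te_form0 (lin0 te_i_j_lin) addr0 scalerDr scalerA addrA.
Qed.

Lemma taut_act_annihilated (T1 : tautExt (lker t)) (F : T1 -> T) v :
  injective j -> te_incl F ->
  (forall a : sqz U, sqz_max a -> taut_act a v = 0) <-> exists x, v = F x.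
Proof.
move=> j_inj [[[Flin _ _] _ _] Fi Fform].
have act_max (f : 'Hom(U, E^o)) u :
    taut_act (0, f) u = 0 <-> te_form (f \o t)%VF u = 0.
  rewrite /taut_act /= scale0r add0r.
  split=> [|->]; last exact: lin0 te_i_j_lin.
  by rewrite -[RHS](lin0 te_i_j_lin) => /te_i_inj/j_inj.
split=> [v0|[x ->] [c f]]; last first.
  rewrite /sqz_max /= => ->; apply/act_max; rewrite Fform -(te_form0 x).
  apply: te_form_eq => y; rewrite memv_ker !lfunE /= => /eqP ->.
  exact: linear0.
(* The preimage of v is built by projecting its tensor to B (x) Ker t, then corrected by an element
   of A. *)
pose pr := projv (lker t).
have [|v1 v1E] := @te_lift _ T1 _
  (fun k => pr (tnth (te_b T) k)) (fun k => te_q k v).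
  by move=> k; exact: memv_proj.
have {}v1E (l : 'Hom(X, E^o)) : te_form l v1 = te_form (l \o pr)%VF v.
  by rewrite v1E; apply: eq_bigr => k _; rewrite !lfunE.
have [l|x xE] := @te_form_ker _ T (v - F v1); last first.
  by exists (te_i T1 x + v1); rewrite (linD Flin) Fi -xE subrK.
rewrite (linB (@te_form_lin _ _ l)) Fform v1E; apply/eqP; rewrite subr_eq0.
pose d : 'Hom(X, E^o) := l - (l \o pr)%VF.
have d_ker x : x \in lker t -> d x = 0.
  by move=> xt; rewrite add_lfunE opp_lfunE comp_lfunE projv_id // subrr.
(* A form vanishing on Ker t factors through t, so the hypothesis on v applies to [d]. *)
have dE : d = ((d \o t^-1) \o t)%VF.
  apply/lfunP => x; rewrite !comp_lfunE; apply/eqP.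
  rewrite -subr_eq0 -linearB; apply/eqP/d_ker.
  by rewrite memv_ker linearB /= limg_lfunVK ?memv_img ?memvf // subrr.
have /act_max := v0 (0, (d \o t^-1)%VF) erefl.
rewrite -dE => dv; rewrite -[X in te_form X v](subrK (l \o pr)%VF).
by rewrite -/d -[d]scale1r te_formP dv scaler0 add0r.
Qed.

End SquareZeroAction.

End Tautological.

(** * Existence and uniqueness of the compatible action *)

Section Descent.
Context (R : realType) (p : nat) (K : padicField p) (E : coefField R K).
Context (Rob : robba E) (n : nat) (alpha : 'I_n -> E) (h : 'I_n -> int).
Context (D : pgdata Rob) (A : autData alpha h).

(** The map [jalg] factors through every principal series; w = 1 is chosen. *)
Lemma jalg_mor : rep_mor (jalg A).
Proof.
have -> : jalg A = fun x => jps A 1%g (Defs.iota A 1%g x).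
  by apply/funext => x; rewrite jps_glue.
have [ilin iact icont] := iota_mor A 1%g.
have [jlin jact jcont] := jps_mor A 1%g.
split=> [a u v|g v gU|q /jcont/icont//]; first by rewrite ilin jlin.
by rewrite iact // jact.
Qed.

Context (XG : pgExtSpace D) (kd : kappaData alpha h XG).
Context (barG : quotSpace (extG0 kd)).
Context (XA : repExtSpace (palg A) (pirep A)) (zd : zetaData XA).
Context (tD : 'Hom(XA, barG)) (tD_P : is_tD zd tD).

(* Were the Ext^1_w too small to span, t_D would not be unique, unless its    *)
(* target vanishes.                                                           *)
Lemma extA_span : \dim {:barG} != 0%N -> (\sum_w extA zd w)%VS = fullv.
Proof.
rewrite dimv_eq0 => barG_neq0; have [tD_kappa tD_uniq] := tD_P.
pose z := vpick {:barG}; have z0 : z != 0 by rewrite vpick0.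
set S := (\sum_w _)%VS; apply/eqP; rewrite eqEsubv subvf; apply/subvP => x _.
pose b := vbasis {:XA}; pose d y := y - projv S y.
suff /eqP : d x = 0 by rewrite subr_eq0 => /eqP ->; exact: memv_proj.
rewrite (coord_basis (vbasisP {:XA}) (memvf (d x))) big1 // => k _.
(* This map vanishes on the span S, so adding it to t_D preserves the defining property; uniqueness
   forces it to be 0, which kills the k-th coordinate of [d x]. *)
pose g y := coord b k (d y) *: z.
have glin : linear g.
  move=> a u v; rewrite /g /d linearP opprD addrACA -scalerBr linearP.
  by rewrite scalerDl scalerA.
pose gL : {linear XA -> barG} :=
  HB.pack g (GRing.isLinear.Build E XA barG *:%R g glin).
have /(congr1 (fun t : 'Hom(XA, barG) => t x)) : tD + linfun gL = tD.
  apply: tD_uniq => w y; rewrite add_lfunE tD_kappa lfunE /= /g /d.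
  rewrite projv_id ?subrr ?linear0 ?scale0r ?addr0 //.
  apply: (subvP (sumv_sup w _ (subvv _))) => //; apply/extAP.
  by exists (kappa kd w y).
rewrite add_lfunE lfunE /= => /eqP; rewrite -subr_eq0 addrAC subrr add0r /g.
by rewrite scaler_eq0 (negPf z0) orbF => /eqP ->; rewrite scale0r.
Qed.

(** As kappa_w is surjective, the form l is determined on all of Ext^1_w, and [te_form] sees nothing
    else. *)
Lemma natural_action_unique w (V : tautExt (extA zd w)) (a : ADw barG w)
    v v1 v2 :
  natural_action (V := V) a v v1 -> natural_action (V := V) a v v2 -> v1 = v2.
Proof.
move=> [l lE ->] [l' lE' ->]; congr (_ + te_i V (jalg A _)).
apply: te_form_eq => _ /extAP[psi ->].
by have [y <-] := kappa_surj kd w psi; rewrite lE lE'.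
Qed.

Context (pi_univ : tautExt (fullv : {vspace XA})).
Context (pi_univ_w : forall w : 'S_n, tautExt (extA zd w)).
Context (inc : forall w : 'S_n, pi_univ_w w -> pi_univ).
Context (inc_P : forall w, te_incl (@inc w)).

Lemma taut_act_factors w :
  factors_naturally (taut_act (T := pi_univ) (jalg A) tD) (@inc w).
Proof.
have [[[inc_lin _ _] _ _] inc_i inc_form] := inc_P w.
move=> a v; exists ((a.1 : E) *: v +
  te_i (pi_univ_w w) (jalg A (te_form (a.2 \o tD)%VF v))); last first.
  by rewrite (linD inc_lin) (linZ inc_lin) inc_i /taut_act inc_form.
exists (a.2 \o tD)%VF => // x.
have [tD_kappa _] := tD_P; rewrite !comp_lfunE tD_kappa lfunE /=.
rewrite vsprojK //; apply: memv_img; exact: subvsP.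
Qed.

Lemma action_unique (act act' : AD barG -> pi_univ -> pi_univ) :
  AD_action act -> (forall w, factors_naturally act (@inc w)) ->
  AD_action act' -> (forall w, factors_naturally act' (@inc w)) ->
  forall a v, act' a v = act a v.
Proof.
move=> [act_mor act1 _ actP] act_nat [act'_mor act'1 _ act'P] act'_nat a v.
have [barG0|] := eqVneq (\dim {:barG}) 0%N.
  (* Here A_D is E, and a is written in the shape k *: 1 + 1 to which linearity of an action
     applies. *)
  have -> : a = ((a.1 : E) - 1) *: 1 + 1.
    have a2 : a.2 = 0.
      apply/lfunP => x; have := @memvf _ barG x.
      move/eqP: barG0; rewrite dimv_eq0 => /eqP ->; rewrite memv0 => /eqP ->.
      by rewrite !linear0.
    case: a a2 => c f /= ->; congr (_, _); last by rewrite /= scaler0 addr0.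
    by rewrite /= [_ *: _]mulr1 subrK.
  by rewrite actP act'P !act1 !act'1.
move=> /extA_span spanE.
have inc_eq w u : act' a (@inc w u) = act a (@inc w u).
  have [u1 u1P ->] := act_nat w a u; have [u2 u2P ->] := act'_nat w a u.
  by rewrite (natural_action_unique u1P u2P).
have [act_lin _ _] := act_mor a; have [act'_lin _ _] := act'_mor a.
have [|x [u ->]] := te_span inc_P v; first by rewrite spanE.
(* The summand from pi lies in every pi^univ_w, in particular for w = 1. *)
have [_ <- _] := inc_P 1%g.
rewrite (linD act_lin) (linD act'_lin) (lin_sum act_lin) (lin_sum act'_lin).
by rewrite inc_eq; congr (_ + _); apply: eq_bigr => w _.
Qed.

End Descent.

(** * Assembly of the action, its uniqueness and the description of pi_1(D) *)

Theorem corollary1p6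
  (R : realType) (p : nat) (K : padicField p) (E : coefField R K)
  (Rob : robba E)
  (n : nat) (n_gt0 : (0 < n)%N)
  (alpha : 'I_n -> E) (h : 'I_n -> int)
  (alpha_neq0 : forall i, alpha i != 0)
  (alpha_generic : forall i j, i != j ->
     alpha i != alpha j /\ alpha i * (alpha j)^-1 != p%:R)
  (h_decr : forall i j : 'I_n, (i < j)%N -> h j < h i)
  (D : pgdata Rob) (D_nc : noncritical_crystalline alpha h D)
  (A : autData alpha h)
  (* Ext^1(D, D), its subspaces Ext^1_w and Ext^1_0, the maps kappa_w, and    *)
  (* the quotient of Ext^1(D, D) by Ext^1_0                                   *)
  (XG : pgExtSpace D) (kd : kappaData alpha h XG) (barG : quotSpace (extG0 kd))
  (* Ext^1(pi_alg, pi), the maps zeta_w and their images Ext^1_w              *)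
  (XA : repExtSpace (palg A) (pirep A)) (zd : zetaData XA)
  (tD : 'Hom(XA, barG)) (tD_P : is_tD zd tD)
  (* pi^univ, its subrepresentations pi^univ_w, and pi_1(D)                   *)
  (pi_univ : tautExt (fullv : {vspace XA}))
  (pi_univ_w : forall w : 'S_n, tautExt (extA zd w))
  (inc : forall w : 'S_n, pi_univ_w w -> pi_univ)
  (inc_P : forall w, te_incl (@inc w))
  (pi_1 : tautExt (lker tD)) :
  exists act : AD barG -> pi_univ -> pi_univ,
    [/\ AD_action act /\ (forall w, factors_naturally act (@inc w)),
        forall act' : AD barG -> pi_univ -> pi_univ,
          AD_action act' -> (forall w, factors_naturally act' (@inc w)) ->
          forall a v, act' a v = act a v
      & iso_subrep pi_1
          (fun v : pi_univ => forall a : AD barG, sqz_max a -> act a v = 0)].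
Proof.
have [[pi_top _] _ _ _] := pi_adm A.
have pa_top := palg_top A.
have pa_finest : forall q, rep_cs (palg A) q <-> seminorm q by exact: palg_cs.
pose act := taut_act (T := pi_univ) (jalg A) tD.
have act_action : AD_action act.
  split=> [a|v|a b v|k a b v].
  - exact: (taut_act_mor pi_top pa_top pa_finest pi_univ (jalg_mor A) tD a).
  - exact: (taut_act1 (jalg_mor A)).
  - exact: (taut_actM (jalg_mor A)).
  exact: (taut_actP (jalg_mor A)).
have act_nat w : factors_naturally act (@inc w) by exact: taut_act_factors.
exists act; split=> // [act' act'_action act'_nat|].
  exact: (action_unique tD_P inc_P).
have [F FP] := te_incl_exists pa_finest pi_1 pi_univ (subvf _).
exists F; first by case: FP.
have jA_inj : injective (jalg A) by exact: jalg_inj.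
by move=> v; exact: (taut_act_annihilated (jalg_mor A) v jA_inj FP).
Qed.
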